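(* Let $k$ be a unital commutative ring and $G$ a group. The pair $\left({\tt Cof}(kG),{\tt Cof}(kG)^{\perp}\right)$ is a cotorsion pair in the category of $kG$-modules, which is cogenerated by a set. In particular, it is a complete cotorsion pair.
   Context: The tensor product $M\otimes_k N$ of two $kG$-modules is a $kG$-module with the diagonal action $g(x\otimes y)=gx\otimes gy$. Let $B=B(G,k)$ be the $kG$-module of all functions $G\to k$ taking only finitely many values, with action $(g\cdot f)(x)=f(g^{-1}x)$. A $kG$-module $M$ is cofibrant if the diagonal $kG$-module $M\otimes_k B$ is projective; ${\tt Cof}(kG)$ is the class of cofibrant $kG$-modules. For a class ${\tt S}$ of modules over a ring $R$, ${\tt S}^{\perp}$ is the class of modules $N$ with ${\rm Ext}^1_R(S,N)=0$ for all $S\in{\tt S}$, and $^{\perp}{\tt S}$ is the class of modules $M$ with ${\rm Ext}^1_R(M,S)=0$ for all $S\in{\tt S}$. A pair $({\tt U},{\tt V})$ is a cotorsion pair if ${\tt U}={}^{\perp}{\tt V}$ and ${\tt U}^{\perp}={\tt V}$. It is cogenerated by a set of modules ${\tt S}$ if ${\tt V}={\tt S}^{\perp}$ (so that ${\tt U}={}^{\perp}({\tt S}^{\perp})$). It is complete if for any module $M$ there are short exact sequences $0\to V\to U\to M\to 0$ and $0\to M\to V'\to U'\to 0$ with $U,U'\in{\tt U}$ and $V,V'\in{\tt V}$. *)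

(* Defs.v *)
From HB Require Import structures.
From mathcomp Require Import all_boot all_order all_algebra finmap all_classical.

Set Implicit Arguments.
Unset Strict Implicit.
Unset Printing Implicit Defensive.

Import GRing.Theory.
Local Open Scope classical_set_scope.
Local Open Scope ring_scope.

(** * Homological algebra over a ring

    Modules over [R] are left modules, that is, objects of [lmodType R]; a class
    of modules is a predicate on [lmodType R]. *)

Section Modules.
Variable R : pzRingType.

Definition mod_class := lmodType R -> Prop.

Definition surjective (A B : Type) (f : A -> B) := forall y, exists x, f x = y.

Definition exact_at (A B C : lmodType R)
    (f : {linear A -> B}) (g : {linear B -> C}) :=
  forall y, g y = 0 <-> exists x, f x = y.

Definition short_exact (A B C : lmodType R)
    (f : {linear A -> B}) (g : {linear B -> C}) :=
  [/\ injective f, exact_at f g & surjective g].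

Definition projective (P : lmodType R) :=
  forall (A B : lmodType R) (p : {linear A -> B}) (f : {linear P -> B}),
    surjective p -> exists g : {linear P -> A}, forall x, p (g x) = f x.

Record proj_resolution (M : lmodType R) := ProjResolution {
  res_mod : nat -> lmodType R;
  res_d : forall n, {linear res_mod n.+1 -> res_mod n};
  res_aug : {linear res_mod 0 -> M};
  res_projective : forall n, projective (res_mod n);
  res_aug_surj : surjective res_aug;
  res_exact0 : exact_at (res_d 0) res_aug;
  res_exact : forall n, exact_at (res_d n.+1) (res_d n) }.

(** [Ext^1_R(M, N) = 0]: here [Ext^1_R(M, N)] is the first cohomology group of
    the complex [Hom_R(P, N)], for [P] a projective resolution of [M]. It does
    not depend on [P], and every [M] has a resolution ([proj_resolutionP]
    below). *)
Definition Ext1_eq0 (M N : lmodType R) :=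
  forall (P : proj_resolution M) (f : {linear res_mod P 1 -> N}),
    (forall x, f (res_d P 1 x) = 0) ->
    exists g : {linear res_mod P 0 -> N}, forall x, f x = g (res_d P 0 x).

Definition right_perp (S : mod_class) : mod_class :=
  fun N => forall M, S M -> Ext1_eq0 M N.

Definition left_perp (S : mod_class) : mod_class :=
  fun M => forall N, S N -> Ext1_eq0 M N.

Definition cotorsion_pair (U V : mod_class) :=
  (forall M, U M <-> left_perp V M) /\ (forall N, right_perp U N <-> V N).

(** A set of modules is a family of modules indexed by a type in the universe of
    the underlying types of modules. This universe is strictly below that of
    [lmodType R], so that the class of all modules is not such a family. *)
Definition small := Type@{GRing.Lmodule.axioms_.u0}.

Definition cogenerated_by_set (U V : mod_class) :=
  exists (I : small) (S : I -> lmodType R),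
    forall N, V N <-> right_perp (fun M => exists i, M = S i) N.

Definition complete_pair (U V : mod_class) :=
  forall M : lmodType R,
    (exists (V0 U0 : lmodType R)
            (i : {linear V0 -> U0}) (p : {linear U0 -> M}),
        [/\ V V0, U U0 & short_exact i p]) /\
    (exists (V1 U1 : lmodType R)
            (i : {linear M -> V1}) (p : {linear V1 -> U1}),
        [/\ V V1, U U1 & short_exact i p]).

End Modules.

(** * Free modules: functions with finite support *)

Section FreeModule.
Variables (R : pzRingType) (X : choiceType).

Definition finsupp_pred : {pred X -> R^o} :=
  fun f => `[< finite_set [set x | f x != 0] >].

Fact finsupp_submod : submod_closed finsupp_pred.
Proof.
split=> [|a f g /asboolP fF /asboolP gF]; apply/asboolP.
  by rewrite (_ : mkset _ = set0) // -subset0 => x /=; rewrite eqxx.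
apply: (@sub_finite_set _ _ ([set x | f x != 0] `|` [set x | g x != 0])).
  move=> x /=; have [fx0|] := eqVneq (f x) 0; last by left.
  by rewrite (_ : (a *: f + g) x = a * f x + g x) // fx0 mulr0 add0r; right.
by rewrite finite_setU.
Qed.

HB.instance Definition _ :=
  GRing.isSubmodClosed.Build R (X -> R^o) finsupp_pred finsupp_submod.

Record free_mod := FreeMod {
  free_val :> X -> R^o;
  _ : free_val \in finsupp_pred }.

HB.instance Definition _ := [isSub for free_val].
HB.instance Definition _ := [Choice of free_mod by <:].
HB.instance Definition _ := [SubChoice_isSubLmodule of free_mod by <:].

Fact delta_subproof (x : X) : (fun y => (y == x)%:R : R^o) \in finsupp_pred.
Proof.
apply/asboolP; apply: (@sub_finite_set _ _ [set x]); last exact: finite_set1.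
by move=> y /=; case: (y =P x) => // _; rewrite eqxx.
Qed.

Definition delta (x : X) : free_mod := FreeMod (delta_subproof x).

(** The linear extension of [phi] from the basis [delta x] to the free module. *)
Definition lin_ext (V : lmodType R) (phi : X -> V) (u : free_mod) : V :=
  \sum_(x \in [set: X]) (u x : R) *: phi x.

Lemma eq_lin_ext (V : lmodType R) (phi psi : X -> V) (u : free_mod) :
  phi =1 psi -> lin_ext phi u = lin_ext psi u.
Proof. by move=> /funext ->. Qed.

Lemma lin_extE (V : lmodType R) (phi : X -> V) (u : free_mod) (r : seq X) :
  uniq r -> (forall x, u x != 0 -> x \in r) ->
  lin_ext phi u = \sum_(x <- r) (u x : R) *: phi x.
Proof.
move=> r_uniq ru; rewrite /lin_ext (fsbigE r) //.
  by apply: eq_bigl => x; rewrite in_setT.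
move=> x _ xr; rewrite (_ : u x = 0) ?scale0r //.
by apply/eqP/negPn/negP => /ru; rewrite (negPf xr).
Qed.

Definition supp (u : free_mod) : seq X := enum_fset (fset_set [set x | u x != 0]).

Lemma supp_uniq u : uniq (supp u). Proof. exact: fset_uniq. Qed.

Lemma suppP u x : (x \in supp u) = (u x != 0).
Proof.
have /asboolP fu := valP u.
rewrite -[x \in supp u]/(x \in fset_set _) in_fset_set //.
by apply/idP/idP; rewrite in_setE.
Qed.

Lemma lin_ext_is_linear (V : lmodType R) (phi : X -> V) :
  linear (lin_ext phi).
Proof.
move=> a u v.
have E x : free_val (a *: u + v) x = a * u x + v x by [].
pose r := undup (supp u ++ supp v).
have ru x : u x != 0 -> x \in r by rewrite mem_undup mem_cat !suppP => ->.
have rv x : v x != 0 -> x \in r.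
  by rewrite mem_undup mem_cat !suppP orbC => ->.
have r0 : uniq r by exact: undup_uniq.
rewrite (lin_extE phi r0 ru) (lin_extE phi r0 rv) (lin_extE phi r0); last first.
  move=> x; rewrite E; have [ux0|/ru//] := eqVneq (u x) 0.
  by rewrite ux0 mulr0 add0r; exact: rv.
rewrite scaler_sumr -big_split; apply: eq_bigr => x _.
by rewrite E scalerDl scalerA.
Qed.

HB.instance Definition _ (V : lmodType R) (phi : X -> V) :=
  GRing.isLinear.Build R free_mod V *:%R (lin_ext phi) (lin_ext_is_linear phi).

Lemma lin_ext_delta (V : lmodType R) (phi : X -> V) x :
  lin_ext phi (delta x) = phi x.
Proof.
rewrite (@lin_extE _ _ _ [:: x]) //; last first.
  by move=> y /=; rewrite inE; case: (y =P x) => // _; rewrite eqxx.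
by rewrite big_seq1 /= eqxx scale1r.
Qed.

Lemma free_modE (u : free_mod) : u = lin_ext delta u.
Proof.
rewrite (lin_extE _ (supp_uniq u)) => [|x]; last by rewrite suppP.
apply/val_inj/funext => x.
have -> : val (\sum_(y <- supp u) (u y : R) *: delta y) x =
          \sum_(y <- supp u) u y * (x == y)%:R.
  elim: (supp u) => [|y s IHs]; first by rewrite !big_nil.
  by rewrite !big_cons -IHs.
have [xu|] := boolP (x \in supp u).
  rewrite (bigD1_seq x) ?supp_uniq //= eqxx mulr1 big1 ?addr0 // => y.
  by rewrite eq_sym => /negPf ->; rewrite mulr0.
rewrite suppP negbK => /eqP /= ux0; rewrite big1_seq // => y /andP[_].
by rewrite suppP; case: (x =P y) => [<-|_ _]; rewrite ?ux0 ?eqxx ?mulr0.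
Qed.

Lemma lin_ext_comp (U V : lmodType R) (f : {linear U -> V}) (phi : X -> U) u :
  f (lin_ext phi u) = lin_ext (f \o phi) u.
Proof.
rewrite !(lin_extE _ (supp_uniq u)); try by move=> x; rewrite suppP.
by rewrite linear_sum; apply: eq_bigr => x _; rewrite linearZ.
Qed.

End FreeModule.

Arguments lin_ext {R X V} phi u.

(** Two linear maps that agree on the basis are equal. *)
Lemma free_mod_ext (R : pzRingType) (X : choiceType) (V : lmodType R)
    (f g : {linear free_mod R X -> V}) :
  (forall x, f (delta R x) = g (delta R x)) -> forall u, f u = g u.
Proof.
move=> fg u; rewrite [u]free_modE !lin_ext_comp.
by apply: eq_lin_ext => x; exact: fg.
Qed.

Lemma lin_ext_linearl (k : comPzRingType) (X : choiceType) (V : lmodType k)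
    (a : k) (phi psi : X -> V) u :
  lin_ext (a *: phi + psi) u = a *: lin_ext phi u + lin_ext psi u.
Proof.
rewrite !(lin_extE _ (supp_uniq u)); try by move=> x; rewrite suppP.
rewrite scaler_sumr -big_split; apply: eq_bigr => x _ /=.
by rewrite scalerDr !scalerA mulrC.
Qed.

(** * Existence of projective resolutions *)

Lemma free_projective (R : pzRingType) (X : choiceType) :
  projective (free_mod R X : lmodType R).
Proof.
move=> A B p f p_surj; have [s sP] := choice p_surj.
exists (lin_ext (fun x => s (f (delta R x))) : {linear free_mod R X -> A}).
apply: (free_mod_ext (f := p \o lin_ext (fun x => s (f (delta R x))))) => x.
by rewrite /= lin_ext_delta sP.
Qed.

Section Kernel.
Variables (R : pzRingType) (A B : lmodType R) (f : {linear A -> B}).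

Definition ker_pred : {pred A} := fun x => f x == 0.

Fact ker_submod : submod_closed ker_pred.
Proof.
split=> [|a u v /eqP fu /eqP fv]; apply/eqP; first exact: linear0.
by rewrite linearP fu fv scaler0 addr0.
Qed.

HB.instance Definition _ := GRing.isSubmodClosed.Build R A ker_pred ker_submod.

Record ker_mod := KerMod { ker_val : A; _ : ker_val \in ker_pred }.

HB.instance Definition _ := [isSub for ker_val].
HB.instance Definition _ := [Choice of ker_mod by <:].
HB.instance Definition _ := [SubChoice_isSubLmodule of ker_mod by <:].

End Kernel.

Section Resolution.
Variables (R : pzRingType) (M : lmodType R).

Definition cover (N : lmodType R) : {linear free_mod R N -> N} := lin_ext id.

Lemma cover_surj N : surjective (cover N).
Proof. by move=> x; exists (delta R x); rewrite /= lin_ext_delta. Qed.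

Fixpoint syzygy (n : nat) : lmodType R :=
  if n is n'.+1 then ker_mod (cover (syzygy n')) else M.

Definition syz_d n :
    {linear free_mod R (syzygy n.+1) -> free_mod R (syzygy n)} :=
  (val : {linear ker_mod (cover (syzygy n)) -> _}) \o cover (syzygy n.+1).

Lemma syz_exact n : exact_at (syz_d n) (cover (syzygy n)).
Proof.
move=> y; split=> [/eqP yK|[x <-]]; last first.
  by apply/eqP; exact: (valP (cover (syzygy n.+1) x)).
have [x xE] := cover_surj (KerMod yK : syzygy n.+1).
by exists x; rewrite /= xE.
Qed.

Lemma proj_resolutionP : inhabited (proj_resolution M).
Proof.
constructor.
apply: (@ProjResolution R M (fun n => free_mod R (syzygy n)) syz_d
  (cover (syzygy 0))) => [n|||n].
- exact: free_projective.
- exact: cover_surj.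
- exact: syz_exact.
move=> y; split=> [y0|[x <-]].
  apply/syz_exact/val_inj; exact: y0.
have /= -> : cover (syzygy n.+1) (syz_d n.+1 x) = 0 by apply/syz_exact; exists x.
by [].
Qed.

End Resolution.

(** * The group algebra *)

Section GroupAlgebra.
Variables (k : comPzRingType) (G : groupType).

Definition group_alg : Type := free_mod k G.
HB.instance Definition _ := GRing.Lmodule.on group_alg.

Implicit Types u v w : group_alg.

Definition ga_elt (g : G) : group_alg := delta k g.

(** The bilinear product with [ga_elt g * ga_elt h = ga_elt (g * h)]. *)
Definition ga_mul u v : group_alg :=
  lin_ext (fun g => lin_ext (fun h => ga_elt (g * h)%g) v) u.

Lemma ga_mul_elt g h : ga_mul (ga_elt g) (ga_elt h) = ga_elt (g * h)%g.
Proof. by rewrite /ga_mul !lin_ext_delta. Qed.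

Lemma ga_mul_linearl v : linear (ga_mul^~ v).
Proof. exact: lin_ext_is_linear. Qed.

Lemma ga_mul_linearr u : linear (ga_mul u).
Proof.
move=> a v w; rewrite /ga_mul -lin_ext_linearl.
by apply: eq_lin_ext => g; rewrite linearP.
Qed.

(** The action of [k[G]] extending an action [rho] of [G]. *)
Definition ga_act (V : lmodType k) (rho : G -> V -> V) u (x : V) : V :=
  lin_ext (fun g => rho g x) u.

Section Action.
Variables (V : lmodType k) (rho : G -> {linear V -> V}).
Hypothesis rho1 : forall x, rho 1%g x = x.
Hypothesis rhoM : forall g h x, rho (g * h)%g x = rho g (rho h x).

Lemma ga_act1 x : ga_act rho (ga_elt 1%g) x = x.
Proof. by rewrite /ga_act lin_ext_delta rho1. Qed.

Lemma ga_actM u v x :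
  ga_act rho (ga_mul u v) x = ga_act rho u (ga_act rho v x).
Proof.
rewrite /ga_act /ga_mul lin_ext_comp; apply: eq_lin_ext => g /=.
rewrite !lin_ext_comp; apply: eq_lin_ext => h /=.
by rewrite lin_ext_delta rhoM.
Qed.

Lemma ga_act_linearl x : linear (ga_act rho ^~ x).
Proof. exact: lin_ext_is_linear. Qed.

Lemma ga_act_linearr u : linear (ga_act rho u).
Proof.
move=> a x y; rewrite /ga_act -lin_ext_linearl.
by apply: eq_lin_ext => g; rewrite linearP.
Qed.

End Action.

Definition ga_translate (g : G) (u : group_alg) : group_alg :=
  lin_ext (fun h => ga_elt (g * h)%g) u.

Fact ga_translate_linear g : linear (ga_translate g).
Proof. exact: lin_ext_is_linear. Qed.
HB.instance Definition _ g := GRing.isLinear.Build k group_alg group_alg *:%R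
  (ga_translate g) (ga_translate_linear g).

Lemma ga_translate1 u : ga_translate 1%g u = u.
Proof.
rewrite [RHS]free_modE /ga_translate.
by apply: eq_lin_ext => h; rewrite mul1g.
Qed.

Lemma ga_translateM g h u :
  ga_translate (g * h)%g u = ga_translate g (ga_translate h u).
Proof.
rewrite /ga_translate lin_ext_comp; apply: eq_lin_ext => x /=.
by rewrite lin_ext_delta mulgA.
Qed.

Fact ga_mulA : associative ga_mul.
Proof.
move=> u v w; apply/esym.
exact: (ga_actM (rho := fun g => ga_translate g) ga_translateM).
Qed.

Fact ga_mul1 : left_id (ga_elt 1%g) ga_mul.
Proof. exact: (ga_act1 (rho := fun g => ga_translate g) ga_translate1). Qed.

Fact ga_mulr1 : right_id (ga_elt 1%g) ga_mul.
Proof.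
move=> u; rewrite [RHS]free_modE /ga_mul.
by apply: eq_lin_ext => g; rewrite lin_ext_delta mulg1.
Qed.

Fact ga_mulDl : left_distributive ga_mul +%R.
Proof. by move=> u v w; have := ga_mul_linearl w 1 u v; rewrite !scale1r. Qed.

Fact ga_mulDr : right_distributive ga_mul +%R.
Proof. by move=> u v w; have := ga_mul_linearr u 1 v w; rewrite !scale1r. Qed.

HB.instance Definition _ := GRing.Zmodule_isPzRing.Build group_alg
  ga_mulA ga_mul1 ga_mulr1 ga_mulDl ga_mulDr.

Lemma ga_scalerAl (a : k) u v : a *: (u * v) = (a *: u) * v.
Proof. exact/esym/(GRing.scalable_linear (ga_mul_linearl v)). Qed.

Lemma ga_scalerAr (a : k) u v : a *: (u * v) = u * (a *: v).
Proof. exact/esym/(GRing.scalable_linear (ga_mul_linearr u)). Qed.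

End GroupAlgebra.

Arguments ga_elt k {G} g.

(** * Modules over the group algebra *)

Section GroupModules.
Variables (k : comPzRingType) (G : groupType).
Notation kG := (group_alg k G).

(** Restriction of scalars along [k -> kG]. *)
Definition restr (M : lmodType kG) : Type := M.

Section Restriction.
Variable M : lmodType kG.

HB.instance Definition _ := GRing.Zmodule.on (restr M).

Definition restr_scale (a : k) (x : restr M) : restr M :=
  (a *: (1 : kG)) *: (x : M).

Fact restr_scaleA a b x : restr_scale a (restr_scale b x) =
  restr_scale (a * b) x.
Proof. by rewrite /restr_scale scalerA -ga_scalerAl mul1r scalerA. Qed.

Fact restr_scale1 : left_id 1 restr_scale.
Proof. by move=> x; rewrite /restr_scale !scale1r. Qed.

Fact restr_scaleDr : right_distributive restr_scale +%R.
Proof. by move=> a x y; rewrite /restr_scale scalerDr. Qed.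

Fact restr_scaleDl x : {morph restr_scale^~ x : a b / a + b}.
Proof. by move=> a b; rewrite /restr_scale !scalerDl. Qed.

HB.instance Definition _ := GRing.Zmodule_isLmodule.Build k (restr M)
  restr_scaleA restr_scale1 restr_scaleDr restr_scaleDl.

Definition gact (g : G) (x : restr M) : restr M := ga_elt k g *: (x : M).

Fact gact_linear g : linear (gact g).
Proof.
move=> a x y; rewrite /gact scalerDr; congr (_ + _).
change (ga_elt k g *: ((a *: (1 : kG)) *: (x : M)) =
        (a *: (1 : kG)) *: (ga_elt k g *: (x : M))).
by rewrite !scalerA -ga_scalerAr -ga_scalerAl mulr1 mul1r.
Qed.
HB.instance Definition _ g := GRing.isLinear.Build k (restr M) (restr M) *:%R
  (gact g) (gact_linear g).

Lemma gact1 x : gact 1%g x = x.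
Proof. exact: (scale1r (x : M)). Qed.

Lemma gactM g h x : gact (g * h)%g x = gact g (gact h x).
Proof. by rewrite /gact scalerA -[_ * _]/(ga_mul _ _) ga_mul_elt. Qed.

End Restriction.

(** A [k]-module with a [k]-linear action of [G], and the corresponding
    [kG]-module. *)
Record grep := GRep {
  grep_mod :> lmodType k;
  grep_act : G -> {linear grep_mod -> grep_mod};
  grep_act1 : forall x, grep_act 1%g x = x;
  grep_actM : forall g h x, grep_act (g * h)%g x = grep_act g (grep_act h x) }.

Definition grep_carrier (V : grep) : Type := V.

Section GrepModule.
Variable V : grep.

HB.instance Definition _ := GRing.Zmodule.on (grep_carrier V).

Definition grep_scale (u : kG) (x : grep_carrier V) : grep_carrier V :=
  ga_act (grep_act V) u x.

Fact grep_scaleA u v x : grep_scale u (grep_scale v x) = grep_scale (u * v) x.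
Proof. exact/esym/ga_actM/grep_actM. Qed.

Fact grep_scale1 : left_id 1 grep_scale.
Proof. exact/ga_act1/grep_act1. Qed.

Fact grep_scaleDr : right_distributive grep_scale +%R.
Proof.
move=> u x y; have := ga_act_linearr (grep_act V) u 1 x y.
by rewrite !scale1r.
Qed.

Fact grep_scaleDl x : {morph grep_scale^~ x : u v / u + v}.
Proof.
move=> u v; have := ga_act_linearl (grep_act V) x 1 u v.
by rewrite !scale1r.
Qed.

HB.instance Definition _ := GRing.Zmodule_isLmodule.Build kG (grep_carrier V)
  grep_scaleA grep_scale1 grep_scaleDr grep_scaleDl.

Definition module_of_grep : lmodType kG := grep_carrier V.

Lemma module_of_grep_act g (x : restr module_of_grep) :
  gact g x = grep_act V g x.
Proof. exact: (lin_ext_delta (fun h => grep_act V h (x : V)) g). Qed.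

Lemma module_of_grep_scale (a : k) (x : restr module_of_grep) :
  a *: x = a *: (x : V).
Proof.
change (lin_ext (fun g => grep_act V g x) (a *: ga_elt k 1%g) = a *: (x : V)).
by rewrite linearZ /= lin_ext_delta grep_act1.
Qed.

End GrepModule.

End GroupModules.

Arguments gact {k G M} g x.

(** * Tensor products of modules over a commutative ring *)

Section Quotient.
Variables (R : pzRingType) (V : lmodType R) (I : submodClosed V).

Definition submod_pred : {pred V} := I.

Fact submod_predP : submod_closed submod_pred.
Proof. by split=> [|a u v Iu Iv]; [exact: rpred0 | rewrite rpredD ?rpredZ]. Qed.

HB.instance Definition _ :=
  GRing.isSubmodClosed.Build R V submod_pred submod_predP.

Definition mod_quot : Type := Quotient.quot submod_pred.
HB.instance Definition _ := GRing.Zmodule.on mod_quot.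

Definition quot_pi (x : V) : mod_quot := \pi_(Quotient.quot submod_pred)%qT x.
Definition quot_repr (x : mod_quot) : V := repr (x : Quotient.quot submod_pred).

Lemma quot_reprK x : quot_pi (quot_repr x) = x.
Proof. exact: reprK. Qed.

Lemma quot_pi_eq x y : quot_pi x = quot_pi y <-> x - y \in I.
Proof.
rewrite -[x - y \in I]/(x - y \in submod_pred) Quotient.idealrBE.
by split=> /eqP.
Qed.

Lemma quot_piD x y : quot_pi (x + y) = quot_pi x + quot_pi y.
Proof. exact: (raddfD (\pi_(Quotient.quot submod_pred)%qT)). Qed.

Definition quot_scale (a : R) (x : mod_quot) : mod_quot :=
  quot_pi (a *: quot_repr x).

Lemma quot_piZ a x : quot_pi (a *: x) = quot_scale a (quot_pi x).
Proof.
apply/quot_pi_eq; rewrite -scalerBr rpredZ //.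
by apply/quot_pi_eq; rewrite quot_reprK.
Qed.

Fact quot_scaleA a b x : quot_scale a (quot_scale b x) = quot_scale (a * b) x.
Proof. by rewrite -(quot_reprK x) -!quot_piZ scalerA. Qed.

Fact quot_scale1 : left_id 1 quot_scale.
Proof. by move=> x; rewrite -(quot_reprK x) -!quot_piZ scale1r. Qed.

Fact quot_scaleDr : right_distributive quot_scale +%R.
Proof.
move=> a x y; rewrite -(quot_reprK x) -(quot_reprK y).
by rewrite -!quot_piZ -!quot_piD -quot_piZ scalerDr.
Qed.

Fact quot_scaleDl x : {morph quot_scale^~ x : a b / a + b}.
Proof.
by move=> a b; rewrite -(quot_reprK x) -!quot_piZ scalerDl quot_piD.
Qed.

HB.instance Definition _ := GRing.Zmodule_isLmodule.Build R mod_quot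
  quot_scaleA quot_scale1 quot_scaleDr quot_scaleDl.

Fact quot_pi_linear : linear quot_pi.
Proof. by move=> a x y; rewrite quot_piD quot_piZ. Qed.
HB.instance Definition _ :=
  GRing.isLinear.Build R V mod_quot *:%R quot_pi quot_pi_linear.

End Quotient.

Section Tensor.
Variables (k : comPzRingType) (M N : lmodType k).
Notation F := (free_mod k (M * N)%type).

(** The submodule of relations of the tensor product. *)
Inductive tensor_rel : F -> Prop :=
| tensor_rel0 : tensor_rel 0
| tensor_relP a u v : tensor_rel u -> tensor_rel v -> tensor_rel (a *: u + v)
| tensor_rell a x x' y :
    tensor_rel (delta k (a *: x + x', y) - (a *: delta k (x, y) + delta k (x', y)))
| tensor_relr a x y y' :
    tensor_rel (delta k (x, a *: y + y') - (a *: delta k (x, y) + delta k (x, y'))).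

Definition tensor_pred : {pred F} := fun u => `[< tensor_rel u >].

Fact tensor_pred_submod : submod_closed tensor_pred.
Proof.
split=> [|a u v /asboolP ru /asboolP rv]; apply/asboolP.
  exact: tensor_rel0.
exact: tensor_relP.
Qed.

HB.instance Definition _ :=
  GRing.isSubmodClosed.Build k F tensor_pred tensor_pred_submod.

Definition tensor : lmodType k := mod_quot tensor_pred.

Definition tens (x : M) (y : N) : tensor := quot_pi _ (delta k (x, y)).

Lemma tens_linearl y : linear (tens^~ y).
Proof.
move=> a x x'; rewrite /tens -linearP; apply/quot_pi_eq/asboolP.
exact: tensor_rell.
Qed.

Lemma tens_linearr x : linear (tens x).
Proof.
move=> a y y'; rewrite /tens -linearP; apply/quot_pi_eq/asboolP.
exact: tensor_relr.
Qed.

Lemma tensor_ext (V : lmodType k) (f g : {linear tensor -> V}) :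
  (forall x y, f (tens x y) = g (tens x y)) -> forall t, f t = g t.
Proof.
move=> fg t; rewrite -(quot_reprK t).
pose p : {linear F -> tensor} := @quot_pi _ _ tensor_pred.
apply: (@free_mod_ext _ _ _ (f \o p) (g \o p)) => -[x y].
exact: fg.
Qed.

(** The linear map out of the tensor product given by a bilinear map. *)
Section Lift.
Variables (V : lmodType k) (b : M -> N -> V).
Hypothesis b_linearl : forall y, linear (b^~ y).
Hypothesis b_linearr : forall x, linear (b x).

Definition tensor_lift (t : tensor) : V :=
  lin_ext (fun p => b p.1 p.2) (quot_repr t).

Lemma tensor_lift_pi u :
  tensor_lift (quot_pi _ u) = lin_ext (fun p => b p.1 p.2) u.
Proof.
apply/eqP; rewrite -subr_eq0 -linearB /=; apply/eqP.
have : quot_repr (quot_pi tensor_pred u) - u \in tensor_pred.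
  by apply/quot_pi_eq; rewrite quot_reprK.
move: (_ - u) => d /asboolP; elim=> [|a v w _ v0 _ w0|a x x' y|a x y y'].
- by rewrite linear0.
- by rewrite linearP /= v0 w0 scaler0 addr0.
- by rewrite linearB linearP /= !lin_ext_delta /= b_linearl subrr.
- by rewrite linearB linearP /= !lin_ext_delta /= b_linearr subrr.
Qed.

Lemma tensor_lift_tens x y : tensor_lift (tens x y) = b x y.
Proof. by rewrite tensor_lift_pi lin_ext_delta. Qed.

Lemma tensor_lift_linear : linear tensor_lift.
Proof.
move=> a s t; rewrite -(quot_reprK s) -(quot_reprK t) -linearP.
by rewrite !tensor_lift_pi linearP.
Qed.

End Lift.

End Tensor.

(** The endomorphism [f (x) g] of [M (x) N]. *)
Section TensorMap.
Variables (k : comPzRingType) (M N : lmodType k).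
Variables (f : {linear M -> M}) (g : {linear N -> N}).

Fact tens_map_linearl y : linear (fun x => tens (f x) (g y)).
Proof. by move=> a x x'; rewrite linearP tens_linearl. Qed.

Fact tens_map_linearr x : linear (fun y => tens (f x) (g y)).
Proof. by move=> a y y'; rewrite linearP tens_linearr. Qed.

Definition tensor_map : tensor M N -> tensor M N :=
  tensor_lift (fun x y => tens (f x) (g y)).

HB.instance Definition _ :=
  GRing.isLinear.Build k (tensor M N) (tensor M N) *:%R tensor_map
    (tensor_lift_linear tens_map_linearl tens_map_linearr).

Lemma tensor_map_tens x y : tensor_map (tens x y) = tens (f x) (g y).
Proof. exact: (tensor_lift_tens tens_map_linearl tens_map_linearr). Qed.

End TensorMap.

(** * Cofibrant modules *)

Section Cofibrant.
Variables (k : comPzRingType) (G : groupType).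
Notation kG := (group_alg k G).

Section Diagonal.
Variables M N : lmodType kG.
Notation T := (tensor (restr M) (restr N)).

Definition diag_act (g : G) : {linear T -> T} :=
  tensor_map (gact g : {linear restr M -> restr M})
             (gact g : {linear restr N -> restr N}).

Fact diag_act1 t : diag_act 1%g t = t.
Proof.
apply: (tensor_ext (g := idfun)) => x y.
by rewrite /= tensor_map_tens /= !gact1.
Qed.

Fact diag_actM g h t : diag_act (g * h)%g t = diag_act g (diag_act h t).
Proof.
apply: (tensor_ext (g := diag_act g \o diag_act h)) => x y.
by rewrite /= !tensor_map_tens /= !gactM.
Qed.

Definition diag_tensor : lmodType kG :=
  module_of_grep (GRep diag_act1 diag_actM).

End Diagonal.

(** The module of functions [G -> k] taking finitely many values. *)
Definition finval_pred : {pred G -> k^o} := fun f => `[< finite_set (range f) >].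

Fact finval_submod : submod_closed finval_pred.
Proof.
split=> [|a f f' /asboolP fF /asboolP fF']; apply/asboolP.
  by apply: (@sub_finite_set _ _ [set 0]); [move=> _ [x _ <-] | exact: finite_set1].
apply: (@sub_finite_set _ _
  ((fun p => a * p.1 + p.2) @` (range f `*` range f'))).
  by move=> _ [x _ <-]; exists (f x, f' x) => //; split; exists x.
by apply/finite_image/finite_setX.
Qed.

HB.instance Definition _ :=
  GRing.isSubmodClosed.Build k (G -> k^o) finval_pred finval_submod.

Record finval_fun := FinvalFun {
  finval_val :> G -> k^o;
  _ : finval_val \in finval_pred }.

HB.instance Definition _ := [isSub for finval_val].
HB.instance Definition _ := [Choice of finval_fun by <:].
HB.instance Definition _ := [SubChoice_isSubLmodule of finval_fun by <:].

Fact finval_act_subproof (g : G) (f : finval_fun) :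
  (fun x => f (g^-1 * x)%g) \in finval_pred.
Proof.
have /asboolP := valP f => fF; apply/asboolP; apply: sub_finite_set fF.
by move=> _ [x _ <-]; exists (g^-1 * x)%g.
Qed.

Definition finval_act (g : G) (f : finval_fun) : finval_fun :=
  FinvalFun (finval_act_subproof g f).

Fact finval_act_linear g : linear (finval_act g).
Proof. by move=> a f f'; apply/val_inj/funext. Qed.
HB.instance Definition _ g :=
  GRing.isLinear.Build k finval_fun finval_fun *:%R (finval_act g)
    (finval_act_linear g).

Fact finval_act1 f : finval_act 1%g f = f.
Proof. by apply/val_inj/funext => x /=; rewrite invg1 mul1g. Qed.

Fact finval_actM g h f :
  finval_act (g * h)%g f = finval_act g (finval_act h f).
Proof. by apply/val_inj/funext => x /=; rewrite invgM mulgA. Qed.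

Definition BGk : lmodType kG :=
  module_of_grep (@GRep k G finval_fun (fun g => finval_act g)
    finval_act1 finval_actM).

Definition Cof : mod_class kG := fun M => projective (diag_tensor M BGk).

End Cofibrant.

Arguments BGk k G : clear implicits.
Arguments Cof k G : clear implicits.

(* Main.v *)
Require Import Defs.
From HB Require Import structures.
From mathcomp Require Import all_boot all_order all_algebra all_classical.

(** A module [M] is cofibrant if and only if [Ext^1(M, Hom_k(B, A)) = 0] for all
    [A], because [B] is projective over [k]; hence the class of cofibrant
    modules is closed under extensions, direct summands and transfinite
    filtrations (Eklof). Conversely, Kaplansky's argument for the projective
    module [M (x) B] filters a cofibrant [M] by cofibrant quotients of one fixed
    free module. These quotients form a set which cogenerates the pair, so that
    the theorem of Eklof and Trlifaj and Salce's lemma give completeness, and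
    completeness gives the cotorsion pair.

    Projectivity of [B] is Noebeling's theorem: the products of characteristic
    functions that are not combinations of lexicographically smaller products
    form a basis.

    Zorn's lemma replaces ordinals throughout: a filtration is a set of
    submodules closed under unions of chains in which every proper term has a
    larger term, and the transfinite small object argument is carried out in one
    step on an inductive type of names of cells. *)

Set Implicit Arguments.
Unset Strict Implicit.
Unset Printing Implicit Defensive.

Import GRing.Theory.
Local Open Scope classical_set_scope.
Local Open Scope ring_scope.

(** * Linear relations *)

(** A set of cogenerators exists because saturating one element of [M] never needs names taken from
    [M]: basis elements are named by their position in a finite support, so words over a type built
    from [B] alone reach the whole closure, and one free module serves all cofibrant modules.

    Partial linear maps occur everywhere, as maps on kernels that are to be extended. They are kept
    as graphs, that is, submodules of a product, to which Zorn's lemma applies directly. A dual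
    basis of [B] over [k] lets such a graph be tensored with [B] coordinate by coordinate, so that
    flatness becomes a computation.

    Over an arbitrary [k] a leading coefficient may be a zero divisor, so a linear relation between
    monomials cannot be solved for its largest term by division. [low_scale] solves it by an
    argument on the points of a cube. *)

Lemma lin_ext_supp (R : pzRingType) (X : choiceType) (V : lmodType R)
    (phi : X -> V) (u : free_mod R X) :
  lin_ext phi u = \sum_(x <- supp u) (u x : R) *: phi x.
Proof. by apply: lin_extE (supp_uniq u) _ => x; rewrite suppP. Qed.

Section Submodules.
Variables (R : pzRingType) (M : lmodType R).

Definition submodule (L : set M) :=
  L 0 /\ forall a x y, L x -> L y -> L (a *: x + y).

Variable L : set M.
Hypothesis L_sub : submodule L.

Lemma submodule0 : L 0. Proof. by case: L_sub. Qed.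

Lemma submoduleD x y : L x -> L y -> L (x + y).
Proof. by case: L_sub => _ + Lx Ly => /(_ 1 _ _ Lx Ly); rewrite scale1r. Qed.

Lemma submoduleZ a x : L x -> L (a *: x).
Proof.
by case: L_sub => L0 + Lx => /(_ a _ _ Lx L0); rewrite addr0.
Qed.

Lemma submoduleN x : L x -> L (- x).
Proof. by rewrite -scaleN1r; exact: submoduleZ. Qed.

Lemma submoduleB x y : L x -> L y -> L (x - y).
Proof. by move=> Lx Ly; apply/submoduleD/submoduleN. Qed.

Lemma submodule_sum (I : Type) (r : seq I) (P : pred I) (F : I -> M) :
  (forall i, P i -> L (F i)) -> L (\sum_(i <- r | P i) F i).
Proof. by move=> LF; apply: big_ind => //; [exact: submodule0|exact: submoduleD]. Qed.

End Submodules.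

Record submod (R : pzRingType) (M : lmodType R) := Submod {
  submod_set : set M;
  submodP : submodule submod_set }.

Section Quotients.
Variables (R : pzRingType) (M : lmodType R) (S : submod M).

Definition submod_mem : {pred M} := fun x => `[< submod_set S x >].

Fact submod_mem_closed : submod_closed submod_mem.
Proof.
have [S0 SP] := submodP S; split=> [|a x y /asboolP Sx /asboolP Sy].
  exact/asboolP.
exact/asboolP/SP.
Qed.

HB.instance Definition _ :=
  GRing.isSubmodClosed.Build R M submod_mem submod_mem_closed.

Definition quot_by : lmodType R := mod_quot submod_mem.

Definition quot_proj : {linear M -> quot_by} := @quot_pi R M submod_mem.

Lemma quot_proj_surj : surjective quot_proj.
Proof. by move=> y; exists (quot_repr y); exact: quot_reprK. Qed.

Lemma quot_proj_eq0 x : quot_proj x = 0 <-> submod_set S x.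
Proof.
rewrite -(linear0 quot_proj) /quot_proj /= quot_pi_eq subr0.
by split=> /asboolP.
Qed.

End Quotients.

Definition mk_linear (R : pzRingType) (U V : lmodType R) (f : U -> V)
    (f_lin : linear f) : {linear U -> V} :=
  HB.pack_for {linear U -> V} f (GRing.isLinear.Build R U V *:%R f f_lin).

Section Relations.
Variables (R : pzRingType) (M N : lmodType R).
Implicit Types G : set (M * N)%type.

(** For a submodule [G] this makes [G] the graph of a linear map on the submodule [rel_dom G]; the
    domain never has to be turned into a module of its own. *)
Definition functional_rel G := forall y, G (0, y) -> y = 0.

Definition rel_dom G : set M := [set x | exists y, G (x, y)].

Lemma submodule_pairP G a x y x' y' : submodule G ->
  G (x, y) -> G (x', y') -> G (a *: x + x', a *: y + y').
Proof. by move=> Gsub xy xy'; exact: (Gsub.2 a _ _ xy xy'). Qed.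

Lemma submodule_pairD G x y x' y' :
  submodule G -> G (x, y) -> G (x', y') -> G (x + x', y + y').
Proof. by move=> Gsub xy xy'; exact: (submoduleD Gsub xy xy'). Qed.

Lemma submodule_pairZ G a x y : submodule G -> G (x, y) -> G (a *: x, a *: y).
Proof. by move=> Gsub xy; exact: (submoduleZ Gsub a xy). Qed.

Lemma submodule_pair_sum (I : eqType) (r : seq I) G (c : I -> R)
    (x : I -> M) (y : I -> N) : submodule G ->
  (forall i, i \in r -> G (x i, y i)) ->
  G (\sum_(i <- r) c i *: x i, \sum_(i <- r) c i *: y i).
Proof.
move=> Gsub; elim: r => [|i r IHr] xy; first by rewrite !big_nil; exact: (submodule0 Gsub).
rewrite !big_cons; apply: submodule_pairP => //; first exact/xy/mem_head.
by apply: IHr => j jr; apply: xy; rewrite inE jr orbT.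
Qed.

Lemma linear_comb (I : Type) (r : seq I) (f : {linear M -> N}) (c : I -> R)
    (x : I -> M) : f (\sum_(i <- r) c i *: x i) = \sum_(i <- r) c i *: f (x i).
Proof. by rewrite linear_sum; apply: eq_bigr => i _; rewrite linearZ. Qed.

Lemma functional_rel_eq G x y z : submodule G -> functional_rel G ->
  G (x, y) -> G (x, z) -> y = z.
Proof.
move=> Gsub Gfun xy xz; apply/eqP; rewrite -subr_eq0; apply/eqP/Gfun.
by rewrite -(subrr x); exact: (submoduleB Gsub xy xz).
Qed.

Lemma linear_of_rel G : submodule G -> functional_rel G ->
  (forall x, rel_dom G x) -> exists f : {linear M -> N}, forall x, G (x, f x).
Proof.
move=> Gsub Gfun Gtot; have [f fP] := choice Gtot.
have f_lin : linear f.
  move=> a x y; apply: (functional_rel_eq Gsub Gfun (fP _)).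
  exact: Gsub.2 (fP x) (fP y).
by exists (mk_linear f_lin).
Qed.

End Relations.

Lemma factor_surj (R : pzRingType) (A B C : lmodType R)
    (q : {linear A -> B}) (f : {linear A -> C}) :
  surjective q -> (forall x, q x = 0 -> f x = 0) ->
  exists g : {linear B -> C}, forall x, g (q x) = f x.
Proof.
move=> q_surj qf.
pose G : set (B * C)%type := [set p | exists x, p = (q x, f x)].
have [||y|g gP] := @linear_of_rel _ _ _ G.
- split=> [|a _ _ [x ->] [x' ->]]; first by exists 0; rewrite !linear0.
  by exists (a *: x + x'); rewrite !linearP.
- by move=> y [x [/esym/qf]] ->.
- by have [x <-] := q_surj y; exists (f x), x.
exists g => x; have [z [qz ->]] := gP (q x).
by apply/eqP; rewrite -subr_eq0 -linearB; apply/eqP/qf; rewrite linearB qz subrr.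
Qed.

(** * Vanishing of Ext as an extension property *)

Section ExtVanishing.
Variable R : pzRingType.
Implicit Types M N A F : lmodType R.

Definition extends_from_ker A M (g : {linear A -> M}) N :=
  forall G : set (A * N)%type, submodule G -> functional_rel G ->
    (forall x, rel_dom G x <-> g x = 0) ->
    exists h : {linear A -> N}, forall x y, G (x, y) -> h x = y.

(** All surjections onto [M] are allowed, so that the property applies to any extension at hand; to
    establish it, one projective presentation suffices. *)
Definition ext_vanish M N :=
  forall A (g : {linear A -> M}), surjective g -> extends_from_ker g N.

(** [A] is the sum of the kernel of [p] and the image of a lift [t] of [g]. The map given on the
    kernel is pulled back along [t] and extended to [e] on [F]; then [t x + v], with [v] in the
    kernel, goes to [e x] plus the value at [v]. *)
Lemma ext_vanish_presentation F M N (g : {linear F -> M}) :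
  projective F -> surjective g -> extends_from_ker g N -> ext_vanish M N.
Proof.
move=> F_proj g_surj gN A p p_surj G Gsub Gfun Gdom.
have [t tP] := F_proj _ _ p g p_surj.
pose G' : set (F * N)%type := [set u | G (t u.1, u.2)].
have [|||e eP] := gN G'.
- split; rewrite /G' /=; first by rewrite linear0; exact: (submodule0 Gsub).
  by move=> a u v Gu Gv; rewrite linearP; exact: Gsub.2 Gu Gv.
- by move=> y; rewrite /G' /= linear0 => /Gfun.
- by move=> x; rewrite -tP -Gdom.
pose H : set (A * N)%type :=
  [set u | exists x v, G v /\ u = (t x + v.1, e x + v.2)].
have Hsub : submodule H.
  split; first by exists 0, (0, 0); rewrite !linear0 !addr0; split=> //; exact: (submodule0 Gsub).
  move=> a _ _ [x [v [Gv ->]]] [x' [v' [Gv' ->]]].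
  exists (a *: x + x'), (a *: v + v'); split; first exact: Gsub.2.
  rewrite !linearP; congr (_, _); rewrite /= !scalerDr;
    by rewrite addrACA.
have Hfun : functional_rel H.
  move=> y [x [[v w] [/= Gv [/esym xv ->]]]].
  have /eP -> : G' (x, - w).
    rewrite /G' /=; have -> : t x = - v by apply/eqP; rewrite -addr_eq0; apply/eqP.
    exact: (submoduleN Gsub Gv).
  by rewrite addNr.
have Htot x : rel_dom H x.
  have [y yx] := g_surj (p x).
  have /Gdom [w Gw] : p (x - t y) = 0 by rewrite linearB tP yx subrr.
  exists (e y + w), y, (x - t y, w); split=> //.
  by congr (_, _); rewrite [RHS]addrC subrK.
have [h hP] := linear_of_rel Hsub Hfun Htot.
exists h => x y xy; apply: (functional_rel_eq Hsub Hfun (hP x)).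
by exists 0, (x, y); rewrite !linear0 !add0r.
Qed.

Lemma Ext1_eq0P M N : Ext1_eq0 M N <-> ext_vanish M N.
Proof.
split=> [MN | MN P f fd].
  have [P] := proj_resolutionP M.
  apply: (ext_vanish_presentation (@res_projective _ _ P 0) (@res_aug_surj _ _ P)).
  move=> G Gsub Gfun Gdom.
  (* The map on the kernel of the augmentation, composed with [res_d P 0], is a cocycle. *)
  pose G' : set (res_mod P 1 * N)%type := [set u | G (res_d P 0 u.1, u.2)].
  have G'fun : functional_rel G' by move=> y; rewrite /G' /= linear0 => /Gfun.
  have G'sub : submodule G'.
    split; rewrite /G' /=; first by rewrite linear0; exact: (submodule0 Gsub).
    by move=> a u v Gu Gv; rewrite linearP; exact: Gsub.2 Gu Gv.
  have [|f fP] := linear_of_rel G'sub G'fun.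
    move=> x; have /Gdom [y xy] : res_aug P (res_d P 0 x) = 0.
      by apply/res_exact0; exists x.
    by exists y.
  have [|g gP] := MN P f.
    move=> x; apply: G'fun; have := fP (res_d P 1 x); rewrite /G' /=.
    by rewrite (_ : res_d P 0 _ = 0) ?linear0 //; apply/res_exact; exists x.
  exists g => x y xy.
  have /Gdom /res_exact0 [z zx] : rel_dom G x by exists y.
  rewrite -zx -gP; apply: (functional_rel_eq Gsub Gfun _ xy).
  by rewrite -zx; exact: fP.
pose G : set (res_mod P 0 * N)%type :=
  [set u | exists x, u = (res_d P 0 x, f x)].
have f0 x : res_d P 0 x = 0 -> f x = 0 by move=> /res_exact [z <-]; exact: fd.
have [|||g gP] := MN _ _ (@res_aug_surj _ _ P) G.
- split; first by exists 0; rewrite !linear0.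
  by move=> a _ _ [x ->] [y ->]; exists (a *: x + y); rewrite !linearP.
- by move=> y [x [/esym/f0]] ->.
- move=> x; split=> [[y [z [-> _]]]|]; first by apply/res_exact0; exists z.
  by move=> /res_exact0 [z <-]; exists (f z), z.
by exists g => x; rewrite (gP _ (f x)) //; exists x.
Qed.

Lemma projective_ext_vanish M N : projective M -> ext_vanish M N.
Proof.
move=> M_proj.
apply: (@ext_vanish_presentation M M N idfun M_proj) => [x|]; first by exists x.
move=> G Gsub Gfun Gdom; exists \0 => x y xy.
have x0 : x = 0 by apply/Gdom; exists y.
by apply/esym/Gfun; rewrite -x0.
Qed.

Lemma ext_vanish_split A M N (g : {linear A -> M}) (i : {linear N -> A}) :
  ext_vanish M N -> short_exact i g ->
  exists s : {linear M -> A}, forall x, g (s x) = x.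
Proof.
move=> MN [i_inj ig g_surj].
pose G : set (A * N)%type := [set u | u.1 = i u.2].
have [|||r rP] := MN _ _ g_surj G.
- split; rewrite /G /=; first by rewrite linear0.
  by move=> a u v -> ->; rewrite linearP.
- by move=> y; rewrite /G /= => y0; apply: i_inj; rewrite -y0 linear0.
- move=> x; rewrite /rel_dom /G /=; by split=> [[y ->]|/ig[y <-]]; [apply/ig; exists y|exists y].
have ri y : r (i y) = y by exact: rP.
(* The section sends [x] to its only preimage in the kernel of the retraction [r]. *)
pose H : set (M * A)%type := [set u | r u.2 = 0 /\ u.1 = g u.2].
have [|||s sP] := @linear_of_rel _ _ _ H.
- split; rewrite /H /=; first by rewrite !linear0.
  by move=> a [? u] [? v] /= [ru ->] [rv ->]; rewrite !linearP ru rv scaler0 addr0.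
- move=> u [/= u0 /esym/ig [y yu]]; move: u0.
  by rewrite -yu ri => ->; rewrite linear0.
- move=> x; have [u <-] := g_surj x; exists (u - i (r u)); split=> /=.
    by rewrite linearB ri subrr.
  by rewrite linearB [g (i _)](_ : _ = 0) ?subr0 //; apply/ig; exists (r u).
by exists s => x; have [_ /= <-] := sP x.
Qed.

End ExtVanishing.

(** * Filtrations and the Eklof lemma *)

(** Adjoining [A0] to every set makes the empty chain harmless, so only nonempty chains need upper
    bounds. *)
Lemma Zorn_above (T : Type) (P : set (set T)) (A0 : set T) :
  P A0 ->
  (forall F : set (set T), F !=set0 -> F `<=` P -> total_on F subset ->
     P (\bigcup_(X in F) X)) ->
  exists A, [/\ P A, A0 `<=` A & forall B, A `<=` B -> P B -> B `<=` A].
Proof.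
move=> PA0 Pchain.
have [|A [PA Amax]] := @Zorn_bigcup T [set X | P (X `|` A0)].
  move=> F FP Ftot /=.
  have [->|/set0P F0] := eqVneq F set0; first by rewrite bigcup_set0 set0U.
  rewrite (_ : _ `|` A0 = \bigcup_(Y in [set X `|` A0 | X in F]) Y); last first.
    rewrite bigcup_image; apply/seteqP; split=> [x [[X FX Xx]|A0x]|x [X FX [Xx|A0x]]].
    - by exists X => //; left.
    - by have [X FX] := F0; exists X => //; right.
    - by left; exists X.
    - by right.
  apply: Pchain => [|_ [X FX <-]|_ _ [X FX <-] [Y FY <-]]; last 1 first.
  - by have [XY|YX] := Ftot _ _ FX FY; [left|right]; apply: setSU.
  - by have [X FX] := F0; exists (X `|` A0), X.
  - exact: FP.
exists (A `|` A0); split=> // B AB PB.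
apply: contrapT => BA; apply: (Amax B).
  split=> [|BA']; first by apply: subset_trans AB; apply: subsetUl.
  by apply: BA; apply: subset_trans BA' _; apply: subsetUl.
by rewrite /= setUidl //; apply: subset_trans AB; apply: subsetUr.
Qed.

Lemma submodule_bigcup (R : pzRingType) (M : lmodType R) (F : set (set M)) :
  F !=set0 -> total_on F subset -> (forall L, F L -> submodule L) ->
  submodule (\bigcup_(L in F) L).
Proof.
move=> [L0 FL0] Ftot Fsub; split; first by exists L0 => //; exact: (Fsub _ FL0).1.
move=> a x y [L FL Lx] [L' FL' Ly].
have [LL'|L'L] := Ftot _ _ FL FL'; [exists L'|exists L] => //.
  by apply: (Fsub _ FL').2 => //; exact: LL'.
by apply: (Fsub _ FL).2 => //; exact: L'L.
Qed.

Section Filtrations.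
Variable R : pzRingType.

(** The subquotient [L' / L] is isomorphic to a member [X] of [C]: both are the
    quotient of the projective module [F] by the same submodule. *)
Definition filtration_step (C : mod_class R) (M : lmodType R) (L L' : set M) :=
  exists (F X : lmodType R) (h : {linear F -> M}) (q : {linear F -> X}),
  [/\ projective F, C X, surjective q,
      forall x, q x = 0 <-> L (h x)
    & forall y, L' y <-> exists l x, L l /\ y = l + h x].

(** Transfinite filtrations, with the ordinal index replaced by the closure of
    the set of all terms under unions of chains. *)
Definition filtered (C : mod_class R) (M : lmodType R) :=
  exists LL : set (set M),
  [/\ forall L, LL L -> submodule L,
      LL [set 0],
      forall F : set (set M), F !=set0 -> F `<=` LL -> total_on F subset ->
        LL (\bigcup_(L in F) L)
    & forall L, LL L -> L = setT \/
        exists L', [/\ LL L', ~ L' `<=` L & filtration_step C L L']].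

Lemma filtered_sub (C C' : mod_class R) M :
  (forall X, C X -> C' X) -> filtered C M -> filtered C' M.
Proof.
move=> CC' [LL [LLsub LL0 LLchain LLstep]]; exists LL; split=> // L /LLstep.
move=> [->|[L' [LL' L'L [F [X [h [q [Fp CX qs qL hL]]]]]]]]; first by left.
right; exists L'; split=> //; exists F, X, h, q; split=> //; exact: CC'.
Qed.

(** Partial extensions whose domain is the preimage of a term of the filtration are ordered by
    inclusion of graphs. A maximal one lies over all of [M], since otherwise it extends across the
    next step. *)
Lemma eklof (M N : lmodType R) :
  filtered (fun X => ext_vanish X N) M -> ext_vanish M N.
Proof.
move=> [LL [LLsub LL0 LLchain LLstep]] A g g_surj G0 G0sub G0fun G0dom.
pose good (G : set (A * N)%type) := [/\ submodule G, functional_rel G, G0 `<=` G &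
  exists L, LL L /\ forall x, rel_dom G x <-> L (g x)].
have good0 : good G0.
  by split=> //; exists [set 0]; split.
have [|G [[Gsub Gfun G0G [L [LLL Gdom]]] _ Gmax]] := Zorn_above good0.
  move=> F F0 Fgood Ftot; split.
  - by apply: submodule_bigcup => // G /Fgood [].
  - by move=> y [G /Fgood[_ Gfun _ _] /Gfun].
  - by have [G FG] := F0; have [_ _ G0G _] := Fgood _ FG; move=> u /G0G Gu; exists G.
  (* Terms lying under comparable graphs are comparable because [g] is surjective, so [D] is a
     chain. *)
  pose D := [set L | LL L /\ exists2 G, F G & forall x, rel_dom G x <-> L (g x)].
  exists (\bigcup_(L in D) L); split.
    apply: LLchain => [|L []//|L L' [_ [G FG GL]] [_ [G' FG' GL']]].
      have [G FG] := F0; have [_ _ _ [L [LLL GL]]] := Fgood _ FG.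
      by exists L; split=> //; exists G.
    have [GG'|G'G] := Ftot _ _ FG FG'; [left|right] => y; have [x <-] := g_surj y.
      by move=> /GL[n xn]; apply/GL'; exists n; exact: GG'.
    by move=> /GL'[n xn]; apply/GL; exists n; exact: G'G.
  move=> x; split=> [[n [G FG xn]]|[L [_ [G FG GL]] /GL[n xn]]].
    have [_ _ _ [L [LLL GL]]] := Fgood _ FG.
    by exists L; [split=> //; exists G|apply/GL; exists n].
  by exists n, G.
suff LT : L = setT.
  have [|h hP] := linear_of_rel Gsub Gfun; first by move=> x; apply/Gdom; rewrite LT.
  by exists h => x y xy; apply: (functional_rel_eq Gsub Gfun (hP x)); exact: G0G.
have [//|[L' [LLL' L'L [F [X [h [q [Fproj Xn q_surj qL L'E]]]]]]]] := LLstep _ LLL.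
case: L'L; have Lsub := LLsub _ LLL.
(* Along a lift [k] of [h], the current partial map induces a map on the kernel of [q]. It extends
   to [e] on [F], and [e] prescribes the values on the image of [k]. *)
have [k kP] := Fproj _ _ g h g_surj.
pose K : set (F * N)%type := [set u | q u.1 = 0 /\ G (k u.1, u.2)].
have [|||e eP] := Xn _ q q_surj K.
- split=> [|a u v [qu Gu] [qv Gv]]; split=> /=; rewrite ?linear0 //.
  + exact: submodule0 Gsub.
  + by rewrite linearP qu qv scaler0 addr0.
  + by rewrite linearP; exact: Gsub.2 Gu Gv.
- by move=> y [_ /=]; rewrite linear0 => /Gfun.
- move=> x; split=> [[y []]//|qx].
  have /Gdom[y xy] : L (g (k x)) by rewrite kP; apply/qL.
  by exists y.
pose G' : set (A * N)%type :=
  [set u | exists v x, G v /\ u = v + (k x, e x)].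
have GG' : G `<=` G'.
  by move=> u Gu; exists u, 0; rewrite !linear0; split=> //; rewrite addr0.
suff good' : good G'.
  move=> y L'y; have [x xy] := g_surj y.
  have [_ _ _ [L1 [_ G'dom]]] := good'.
  have [l [z [Ll yE]]] := (L'E y).1 L'y.
  have [a aE] := g_surj l.
  have /Gdom[n an] : L (g a) by rewrite aE.
  have : G' (a + k z, n + e z) by exists (a, n), z.
  move/(Gmax _ GG' good') => Gaz; rewrite yE -aE -kP -linearD.
  by apply/Gdom; exists (n + e z).
split.
- split; first by apply: GG'; exact: submodule0 Gsub.
  move=> a _ _ [u [x [Gu ->]]] [v [y [Gv ->]]].
  exists (a *: u + v), (a *: x + y); split; first exact: Gsub.2.
  by rewrite !linearP scalerDr addrACA.
- move=> y [[a n] [x [/= Gan [/esym/eqP axE ->]]]].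
  move: axE; rewrite addr_eq0 => /eqP aE.
  have Lhx : L (h x).
    rewrite -kP -[k x]opprK -aE linearN; apply: (submoduleN Lsub).
    by apply/Gdom; exists n.
  have -> : e x = - n.
    apply: eP; split; first exact/qL.
    by rewrite /= -[k x]opprK -aE; exact: (submoduleN Gsub Gan).
  by rewrite addrN.
- exact: subset_trans G0G GG'.
exists L'; split=> // x; split.
  move=> [n [[a n'] [z [Gan [-> _]]]]]; apply/L'E.
  exists (g a), z; split; first by apply/Gdom; exists n'.
  by rewrite linearD kP.
move=> /L'E[l [z [Ll gx]]].
have /Gdom[n xn] : L (g (x - k z)) by rewrite linearB kP gx addrK.
by exists (n + e z), (x - k z, n), z; split=> //; congr (_, _); rewrite subrK.
Qed.

End Filtrations.

(** * Enough modules in the right perpendicular class *)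

Section CellNames.
Variables (R : pzRingType) (Z : choiceType) (N : lmodType R).
Notation F := (free_mod R Z).

(** Names of the cells of a transfinite cell complex over [N]: a name is an
    attaching map, which sends [x : F] to the sum of [n x] and of the elements
    [f x j], for [j < len x], of the cells named [c x j]; only its values on
    [K] matter. Nesting replaces the ordinal number of a stage. *)
Inductive cell_name : Type :=
| null_name
| cell (K : set F) (n : F -> N) (len : F -> nat) (f : F -> nat -> F)
    (c : F -> nat -> cell_name).

HB.instance Definition _ := gen_eqMixin cell_name.
HB.instance Definition _ := gen_choiceMixin cell_name.

Definition cell_complex : lmodType R := (N * free_mod R (cell_name * Z)%type)%type.

Implicit Types (p q : cell_name) (A D : set cell_name) (x y : F) (w : cell_complex).

Definition base (n : N) : cell_complex := (n, 0).

Fact base_linear : linear base.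
Proof. by move=> a n n'; congr (_, _); rewrite /= scaler0 addr0. Qed.
HB.instance Definition _ :=
  GRing.isLinear.Build R N cell_complex *:%R base base_linear.

Definition in_cell p x : cell_complex := (0, lin_ext (fun z => delta R (p, z)) x).

Fact in_cell_linear p : linear (in_cell p).
Proof.
by move=> a x y; congr (_, _); [rewrite /= scaler0 addr0|exact: lin_ext_is_linear].
Qed.
HB.instance Definition _ p :=
  GRing.isLinear.Build R F cell_complex *:%R (in_cell p) (in_cell_linear p).

Definition cell_coord p w : F :=
  lin_ext (fun u : cell_name * Z => if u.1 == p then delta R u.2 else 0) w.2.

Fact cell_coord_linear p : linear (cell_coord p).
Proof. by move=> a v w; exact: lin_ext_is_linear. Qed.
HB.instance Definition _ p :=
  GRing.isLinear.Build R cell_complex F *:%R (cell_coord p) (cell_coord_linear p).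

Lemma cell_coord_base p n : cell_coord p (base n) = 0.
Proof. exact: linear0. Qed.

Lemma cell_coord_in p q x : cell_coord p (in_cell q x) = if q == p then x else 0.
Proof.
rewrite /cell_coord /= lin_ext_comp.
have -> : (if q == p then x else 0) =
    lin_ext (fun z => if q == p then delta R z else 0) x.
  case: eqP => _; first exact: free_modE.
  rewrite (lin_extE _ (supp_uniq x)) => [|z]; last by rewrite suppP.
  by rewrite big1 // => z _; rewrite scaler0.
by apply: eq_lin_ext => z /=; rewrite lin_ext_delta.
Qed.

(** This is the form in which a name records a value of its attaching map: every function from [F]
    to the complex is therefore attached by some name. *)
Lemma complexE w : exists n len (f : nat -> F) (c : nat -> cell_name),
  w = base n + \sum_(j < len) in_cell (c j) (f j).
Proof.
case: w => n u; exists n, (size (supp u)).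
case: (supp u) (supp_uniq u) (@suppP _ _ u) => [|u0 s] s_uniq sP.
  exists (fun=> 0), (fun=> null_name); rewrite big_ord0 addr0; congr (_, _).
  by rewrite [LHS]free_modE (lin_extE _ s_uniq) ?big_nil // => v; rewrite sP.
pose t := u0 :: s.
exists (fun j => (u (nth u0 t j) : R) *: delta R (nth u0 t j).2).
exists (fun j => (nth u0 t j).1).
rewrite -(big_mkord xpredT (fun j => in_cell (nth u0 t j).1
   ((u (nth u0 t j) : R) *: delta R (nth u0 t j).2))).
rewrite -(big_nth u0 xpredT (fun v => in_cell v.1 ((u v : R) *: delta R v.2))).
rewrite (_ : \sum_(v <- t) _ = (0, u)).
  by congr (_, _); rewrite /= ?addr0 ?add0r.
rewrite [in RHS](free_modE u) (lin_extE _ s_uniq) => [|v]; last by rewrite sP.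
rewrite -/t; elim: t => [|v r IHr]; first by rewrite !big_nil.
rewrite !big_cons IHr [LHS]surjective_pairing; congr (_, _); rewrite /= ?addr0 // linearZ /=.
by rewrite lin_ext_delta; case: v.
Qed.

Definition attach p x : cell_complex :=
  if p is cell _ n len f c then
    base (n x) + \sum_(j < len x) in_cell (c x j) (f x j)
  else 0.

Definition cell_ker p : set F := if p is cell K _ _ _ _ then K else set0.

Definition child q p :=
  if p is cell _ _ len _ c then exists x j, (j < len x)%N /\ q = c x j
  else False.

Lemma child_wf : well_founded child.
Proof.
elim=> [|K n len f c IH]; apply: Acc_intro => q; first by [].
by move=> [x [j [_ ->]]]; exact: IH.
Qed.

Inductive below p : cell_name -> Prop :=
| below_child q : child q p -> below p q
| below_trans q r : child r q -> below p q -> below p r.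

Definition lower A := forall p q, A p -> child q p -> A q.

Lemma below_lower p : lower (below p).
Proof. by move=> q r qp rq; exact: below_trans rq qp. Qed.

Lemma below_sub A p : lower A -> (forall q, child q p -> A q) -> below p `<=` A.
Proof.
move=> A_low pA q; elim=> {q} [q /pA//|q r rq _ Aq]; exact: A_low rq.
Qed.

(** The substitute for the next ordinal stage: a cell whose attaching map only meets cells already
    present. *)
Lemma minimal_outside A : A <> setT ->
  exists p, ~ A p /\ forall q, child q p -> A q.
Proof.
move=> AT; apply: contrapT => noP; apply: AT; rewrite -subTset => p _.
elim/(well_founded_ind child_wf): p => p IHp.
by apply: contrapT => Ap; apply: noP; exists p.
Qed.

Inductive span_of A : cell_complex -> Prop :=
| span_of0 : span_of A 0
| span_ofP a v w : span_of A v -> span_of A w -> span_of A (a *: v + w)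
| span_of_base n : span_of A (base n)
| span_of_cell p x : A p -> span_of A (in_cell p x).

Lemma span_of_submodule A : submodule (span_of A).
Proof. by split; [exact: span_of0|move=> *; exact: span_ofP]. Qed.

Lemma span_of_sub A D w : A `<=` D -> span_of A w -> span_of D w.
Proof.
move=> AD; elim=> [|a v u _ ? _ ?|n|p x /AD]; first exact: span_of0.
- exact: span_ofP.
- exact: span_of_base.
- exact: span_of_cell.
Qed.

Lemma span_ofT w : span_of setT w.
Proof.
have [n [len [f [c ->]]]] := complexE w.
apply: (submoduleD (span_of_submodule _)); first exact: span_of_base.
by apply: (submodule_sum (span_of_submodule _)) => j _; exact: span_of_cell.
Qed.

Lemma span_of_coord A p w : ~ A p -> span_of A w -> cell_coord p w = 0.
Proof.
move=> Ap; elim=> [|a v u _ v0 _ u0|n|q x Aq].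
- exact: linear0.
- by rewrite linearP /= v0 u0 scaler0 addr0.
- exact: cell_coord_base.
- by rewrite cell_coord_in; case: eqP => // qp; rewrite qp in Aq.
Qed.

Lemma span_ofU1 A p w : span_of (A `|` [set p]) w ->
  exists v x, span_of A v /\ w = v + in_cell p x.
Proof.
elim=> [|a v u _ [v' [x [Av ->]]] _ [u' [y [Au ->]]]|n|q x [Aq|->]].
- by exists 0, 0; rewrite linear0 addr0; split=> //; exact: span_of0.
- exists (a *: v' + u'), (a *: x + y); split; first exact: span_ofP.
  by rewrite linearP scalerDr addrACA.
- by exists (base n), 0; rewrite linear0 addr0; split=> //; exact: span_of_base.
- exists (in_cell q x), 0; rewrite linear0 addr0; split=> //.
  exact: span_of_cell.
- by exists 0, x; rewrite add0r; split=> //; exact: span_of0.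
Qed.

Lemma attach_below p x : span_of (below p) (attach p x).
Proof.
case: p => [|K n len f c]; first exact: span_of0.
apply: (submoduleD (span_of_submodule _)); first exact: span_of_base.
apply: (submodule_sum (span_of_submodule _)) => j _; apply: span_of_cell.
by apply: below_child; exists x, j.
Qed.

Variable KK : set (set F).
Hypothesis KK_sub : forall K, KK K -> submodule K.

(** A name is valid when its attaching map is linear on [K], modulo the
    relations coming from the cells below it. Invalid names stand for free
    summands. *)
Inductive valid : cell_name -> Prop :=
| valid_cell p : KK (cell_ker p) ->
    (forall a x y, cell_ker p x -> cell_ker p y ->
       cell_rel (below p)
         (attach p (a *: x + y) - (a *: attach p x + attach p y))) ->
    valid p
with cell_rel : set cell_name -> cell_complex -> Prop :=
| cell_rel0 A : cell_rel A 0
| cell_relP A a v w : cell_rel A v -> cell_rel A w -> cell_rel A (a *: v + w)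
| cell_rel_gen A p x : A p -> valid p -> cell_ker p x ->
    cell_rel A (in_cell p x - attach p x).

Lemma valid_inv p : valid p -> KK (cell_ker p) /\
  forall a x y, cell_ker p x -> cell_ker p y ->
    cell_rel (below p)
      (attach p (a *: x + y) - (a *: attach p x + attach p y)).
Proof. by case. Qed.

Lemma cell_rel_submodule A : submodule (cell_rel A).
Proof. by split; [exact: cell_rel0|move=> *; exact: cell_relP]. Qed.

Lemma cell_rel_sub A D w : A `<=` D -> cell_rel A w -> cell_rel D w.
Proof.
move=> + Aw; elim: Aw => [B|B a v u _ IHv _ IHu /[dup]/IHv Dv /IHu Du|B p x Bp ? ? BD].
- by move=> _; exact: cell_rel0.
- exact: cell_relP.
- by apply: cell_rel_gen => //; exact: BD.
Qed.

Lemma cell_rel_span A w : lower A -> cell_rel A w -> span_of A w.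
Proof.
move=> + Aw; elim: Aw => [B|B a v u _ IHv _ IHu /[dup]/IHv Bv /IHu Bu|B p x Bp _ _ B_low].
- by move=> _; exact: span_of0.
- exact: span_ofP.
- apply: (submoduleB (span_of_submodule _)); first exact: span_of_cell.
  apply: span_of_sub (attach_below p x); apply: below_sub => // q.
  exact: B_low.
Qed.

Lemma cell_rel_bigcup (FF : set (set cell_name)) w :
  FF !=set0 -> total_on FF subset -> cell_rel (\bigcup_(A in FF) A) w ->
  exists2 A, FF A & cell_rel A w.
Proof.
move=> [A0 FA0] Ftot; move BE: (\bigcup_(A in FF) A) => B Bw.
elim: Bw BE => [D|D a v u _ IHv _ IHu DE|D p x + vp Kx DE].
- by exists A0 => //; exact: cell_rel0.
- have [A FA Av] := IHv DE; have [A' FA' Au] := IHu DE.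
  have [AA|AA] := Ftot _ _ FA FA'; [exists A'|exists A] => //.
    by apply: cell_relP => //; exact: cell_rel_sub Av.
  by apply: cell_relP => //; exact: cell_rel_sub Au.
- by rewrite -DE => -[A FA Ap]; exists A => //; exact: cell_rel_gen.
Qed.

(** Validity makes [in_cell p x - attach p x] linear in [x] modulo [cell_rel A], so a combination of
    new generators reduces to a single one. An invalid [p] contributes no generator. *)
Lemma cell_relU1 A p w : lower A -> (forall q, child q p -> A q) ->
  cell_rel (A `|` [set p]) w ->
  cell_rel A w \/
  (valid p /\ exists x, cell_ker p x /\ cell_rel A (w - (in_cell p x - attach p x))).
Proof.
move=> A_low pA; have [vp|nvp] := pselect (valid p); last first.
  move=> Bw; left; move BE: (A `|` _) Bw => B Bw.
  elim: Bw BE => [D|D a v u _ IHv _ IHu /[dup]/IHv ? /IHu ?|D q x + vq Kx DE].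
  - by move=> _; exact: cell_rel0.
  - exact: cell_relP.
  - by rewrite -DE => -[Aq|qp]; [exact: cell_rel_gen|rewrite qp in vq].
have /= [KKp p_lin] := valid_inv vp.
have Asub := cell_rel_submodule A.
have Ksub := KK_sub KKp.
have {}p_lin a x y : cell_ker p x -> cell_ker p y ->
    cell_rel A (attach p (a *: x + y) - (a *: attach p x + attach p y)).
  by move=> px py; apply: cell_rel_sub (p_lin a x y px py); exact: below_sub.
have attach0 : cell_rel A (attach p 0).
  have := p_lin 1 0 0 (submodule0 Ksub) (submodule0 Ksub).
  rewrite !scale1r addr0 opprD addrA subrr add0r => /(submoduleN Asub).
  by rewrite opprK.
move=> Bw; right; split=> //.
move BE: (A `|` _) Bw => B Bw.
elim: Bw BE => [D|D a v u _ IHv _ IHu DE|D q x + vq Kx DE].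
- move=> _; exists 0; rewrite linear0 !sub0r opprK; split=> //.
  exact: submodule0 Ksub.
- have [x [Kx Av]] := IHv DE; have [y [Ky Au]] := IHu DE.
  exists (a *: x + y); split; first exact: Ksub.2.
  have := submoduleD Asub (p_lin a x y Kx Ky) (Asub.2 a _ _ Av Au).
  congr (cell_rel A _); rewrite [in_cell p (_ + _)]linearP !scalerBr !opprB !opprD !addrA.
  by rewrite [LHS](ACl ((2*5)*(3*8)*4*7*1*6*9))/= !addNr !add0r.
- rewrite -DE => -[Aq|qp].
    exists 0; rewrite linear0 sub0r opprK; split; first exact: submodule0 Ksub.
    by apply: (submoduleD Asub) => //; exact: cell_rel_gen.
  by exists x; rewrite -qp subrr; split=> //; exact: cell_rel0.
Qed.

(** Attaching cells creates no relation between earlier elements. If a relation over [A] involves a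
    last cell [p] outside [A] with argument [x], comparing coordinates at [p] forces [x] to be 0.
    This stands for the injectivity of pushouts and unions of injections. *)
Lemma cell_rel_pure A w : lower A -> cell_rel setT w -> span_of A w -> cell_rel A w.
Proof.
move=> A_low Tw Aw.
pose good D := lower D /\ forall w, cell_rel D w -> span_of A w -> cell_rel A w.
have goodA : good A by split.
have [|D [[D_low DA] AD Dmax]] := Zorn_above goodA.
  move=> FF F0 FFgood FFtot; split.
    move=> p q [D FD Dp] qp; exists D => //; exact: (FFgood _ FD).1 Dp qp.
  by move=> v /(cell_rel_bigcup F0 FFtot)[D /FFgood[_ DA]] /DA.
suff DT : D = setT by apply: DA => //; rewrite DT.
apply: contrapT => /minimal_outside[p [Dp pD]]; apply: Dp.
apply: (Dmax (D `|` [set p])); first exact: subsetUl; last by right.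
split=> [q r [Dq|->] rq|v]; [by left; exact: D_low rq|by left; exact: pD|].
move=> /(cell_relU1 D_low pD)[/DA//|[vp [x [Kx Dv]]] Av].
have [Dp|nDp] := pselect (D p).
  apply: DA => //; rewrite -[v](subrK (in_cell p x - attach p x)).
  by apply: (submoduleD (cell_rel_submodule D)) => //; exact: cell_rel_gen.
have nAp : ~ A p by move=> /AD.
have x0 : x = 0.
  have := span_of_coord nDp (cell_rel_span D_low Dv).
  rewrite !(linearB (cell_coord p)) /= cell_coord_in eqxx (span_of_coord nAp Av).
  rewrite (span_of_coord nDp (w := attach p x)); last first.
    by apply: span_of_sub (attach_below p x); exact: below_sub.
  by rewrite subr0 sub0r => /eqP; rewrite oppr_eq0 => /eqP.
apply: DA => //; rewrite -[v](subrK (in_cell p x - attach p x)).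
apply: (submoduleD (cell_rel_submodule D)) => //.
have [KKp p_lin] := valid_inv vp.
have := p_lin 1 0 0 (submodule0 (KK_sub KKp)) (submodule0 (KK_sub KKp)).
rewrite x0 linear0 sub0r !scale1r addr0 opprD addrA subrr add0r.
by apply: cell_rel_sub; exact: below_sub.
Qed.

Definition complex_rel : submod cell_complex := Submod (cell_rel_submodule setT).
Definition complex_quot : lmodType R := quot_by complex_rel.
Definition complex_proj : {linear cell_complex -> complex_quot} := quot_proj complex_rel.
Definition complex_base : {linear N -> complex_quot} := complex_proj \o base.

Lemma cell_rel_set0 w : cell_rel set0 w -> w = 0.
Proof.
move AE: set0 => A Aw; elim: Aw AE => // {w A}[A a u v _ IHu _ IHv AE|A p x Ap _ _ AE].
  by rewrite IHu // IHv // scaler0 addr0.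
by rewrite -AE in Ap.
Qed.

Lemma complex_base_inj : injective complex_base.
Proof.
move=> n n' /eqP; rewrite -subr_eq0 -linearB => /eqP.
move=> /quot_proj_eq0 /(@cell_rel_pure set0) nn'.
have /cell_rel_set0 /(congr1 fst) /= /eqP : cell_rel set0 (base (n - n')).
  by apply: nn' => //; exact: span_of_base.
by rewrite subr_eq0 => /eqP.
Qed.

(** Representatives of the values of a map from [K] to the quotient form an attaching map, hence the
    cell [p]. In the quotient this cell is glued along that very map, so its inclusion is the
    extension. Outside [K] the representatives are arbitrary. *)
Lemma complex_quot_ext_vanish (K : set F) (X : lmodType R) (q : {linear F -> X}) :
  KK K -> surjective q -> (forall x, q x = 0 <-> K x) -> ext_vanish X complex_quot.
Proof.
move=> KKK q_surj qK.
apply: (ext_vanish_presentation (@free_projective R Z) q_surj) => G Gsub Gfun Gdom.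
have rep x : exists r : N * nat * (nat -> F) * (nat -> cell_name),
    K x -> G (x, complex_proj
      (base r.1.1.1 + \sum_(j < r.1.1.2) in_cell (r.2 j) (r.1.2 j))).
  have [/qK/Gdom[v xv]|nKx] := pselect (K x); last first.
    by exists (0, 0%N, fun=> 0, fun=> null_name).
  have [w wv] := quot_proj_surj v.
  have [n [len [f [c wE]]]] := complexE w.
  by exists (n, len, f, c); rewrite /= -wE /complex_proj wv.
have [r rP] := choice rep.
pose p := cell K (fun x => (r x).1.1.1) (fun x => (r x).1.1.2)
  (fun x => (r x).1.2) (fun x => (r x).2).
have {rP}attachG x : K x -> G (x, complex_proj (attach p x)) by exact: rP.
have Ksub := KK_sub KKK.
have vp : valid p.
  apply: valid_cell => // a x y Kx Ky.
  (* The representatives are linear modulo all relations; purity brings these down to the relations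
     below [p], as validity demands. *)
  apply: (@cell_rel_pure _ _ (@below_lower p)).
    apply/(quot_proj_eq0 complex_rel)/Gfun; rewrite linearB linearP.
    have Kaxy : K (a *: x + y) by exact: Ksub.2.
    have := submoduleB Gsub (attachG _ Kaxy) (Gsub.2 a _ _ (attachG _ Kx) (attachG _ Ky)).
    congr (G _); rewrite [LHS]surjective_pairing; congr (_, _) => /=.
    by rewrite subrr.
  apply: (submoduleB (span_of_submodule _)); first exact: attach_below.
  by apply: (span_of_submodule _).2; exact: attach_below.
exists (complex_proj \o in_cell p) => x y xy.
have /qK Kx : q x = 0 by apply/Gdom; exists y.
rewrite -(functional_rel_eq Gsub Gfun (attachG _ Kx) xy).
apply/eqP; rewrite -subr_eq0 /= -linearB; apply/eqP/(quot_proj_eq0 complex_rel).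
exact: cell_rel_gen.
Qed.

(** The terms are the images of the lower sets of cells. A step adds one cell [q]: its quotient is
    [F] modulo [cell_ker q] if [q] is valid, and [F] itself if not. *)
Lemma complex_coker_filtered (C : mod_class R) (U : lmodType R)
    (p : {linear complex_quot -> U}) :
  C F ->
  (forall (K : set F) (X : lmodType R) (q : {linear F -> X}),
     KK K -> surjective q -> (forall x, q x = 0 <-> K x) -> C X) ->
  surjective p -> exact_at complex_base p -> filtered C U.
Proof.
move=> CF CK p_surj p_exact.
pose pi : {linear cell_complex -> U} := p \o complex_proj.
have pi0 w : pi w = 0 <-> exists n, cell_rel setT (w - base n).
  rewrite p_exact; split=> -[n wn]; exists n.
    by apply/(quot_proj_eq0 complex_rel); rewrite linearB -wn subrr.
  apply/esym/eqP; rewrite -subr_eq0 -linearB; apply/eqP.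
  exact/(quot_proj_eq0 complex_rel).
have pi_base n : pi (base n) = 0.
  by apply/pi0; exists n; rewrite subrr; exact: cell_rel0.
pose L A : set U := [set u | exists2 w, span_of A w & u = pi w].
have Lsub A : submodule (L A).
  split; first by exists 0; [exact: span_of0|rewrite linear0].
  move=> a _ _ [w Aw ->] [v Av ->]; exists (a *: w + v); first exact: span_ofP.
  by rewrite linearP.
have LS A D : A `<=` D -> L A `<=` L D.
  by move=> AD _ [w Aw ->]; exists w => //; exact: span_of_sub Aw.
have pi_cell A q x : A q -> L A (pi (in_cell q x)).
  by move=> Aq; exists (in_cell q x) => //; exact: span_of_cell.
have L_join (S : set U) A : submodule S ->
    (forall q x, A q -> S (pi (in_cell q x))) -> L A `<=` S.
  move=> Ssub SA _ [w Aw ->]; elim: Aw => [|a v u _ Sv _ Su|n|q x].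
  - by rewrite linear0; exact: submodule0 Ssub.
  - by rewrite linearP; exact: Ssub.2.
  - by rewrite pi_base; exact: submodule0 Ssub.
  - exact: SA.
exists [set M | exists2 A, lower A & M = L A]; split.
- by move=> _ [A _ ->].
- exists set0; first by [].
  apply/seteqP; split=> [_ ->|]; first exact: submodule0 (Lsub _).
  apply: L_join => //; split=> // a x y -> ->.
  by rewrite /= scaler0 addr0.
- move=> FF FF0 FFL FFtot.
  (* Several lower sets may have the same image, so all those with image in the chain are joined. *)
  pose A := \bigcup_(D in [set D | lower D /\ FF (L D)]) D.
  exists A.
    move=> q r [D [D_low FD] Dq] rq; exists D => //; exact: D_low rq.
  apply/seteqP; split=> [u [M FM Mu]|].
    have [D D_low ME] := FFL _ FM; rewrite ME in FM Mu.
    apply: LS Mu; exact: (@bigcup_sup _ _ D).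
  apply: L_join => [|q x [D [D_low FD] Dq]].
    by apply: submodule_bigcup => // M /FFL[D _ ->].
  by exists (L D) => //; exact: pi_cell.
move=> _ [A0 A0_low ->].
(* The largest lower set with the given image: a cell added to [A0] might not enlarge the image, but
   one added to [A] must. *)
pose A := \bigcup_(D in [set D | lower D /\ L D = L A0]) D.
have A_low : lower A.
  move=> q r [D [D_low DE] Dq] rq; exists D => //; exact: D_low rq.
have LA : L A0 = L A.
  apply/seteqP; split; first by apply: LS; exact: (@bigcup_sup _ _ A0).
  by apply: L_join => // q x [D [_ <-]]; exact: pi_cell.
have [AT|/minimal_outside[q [Aq qA]]] := pselect (A = setT).
  left; rewrite LA AT; apply/seteqP; split=> // u _.
  have [v <-] := p_surj u; have [w <-] := quot_proj_surj v.
  by exists w => //; exact: span_ofT.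
right; exists (L (A `|` [set q])).
have A'_low : lower (A `|` [set q]).
  by move=> r s [Ar|->] sr; left; [exact: A_low sr|exact: qA].
split; first by exists (A `|` [set q]).
  move=> LA'; apply: Aq; exists (A `|` [set q]); last by right.
  split=> //; apply/seteqP; split=> //.
  by rewrite LA; apply: LS; exact: subsetUl.
have step x w : span_of A w -> pi (in_cell q x) = pi w ->
    (x = 0) \/ (valid q /\ cell_ker q x).
  move=> Aw /eqP; rewrite -subr_eq0 -linearB => /eqP/pi0[n xw].
  have Awn : span_of A (w + base n).
    by apply: (submoduleD (span_of_submodule _)) => //; exact: span_of_base.
  have {}xw : cell_rel (A `|` [set q]) (in_cell q x - (w + base n)).
    apply: cell_rel_pure => //; first by rewrite opprD addrA.
    apply: (submoduleB (span_of_submodule _)); first by apply: span_of_cell; right.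
    by apply: span_of_sub Awn; exact: subsetUl.
  have coord0 v : span_of A v -> cell_coord q v = 0 by exact: span_of_coord.
  case: (cell_relU1 A_low qA xw) => [/(cell_rel_span A_low)/coord0|].
    by rewrite (linearB (cell_coord q)) /= cell_coord_in eqxx (coord0 _ Awn) subr0; left.
  move=> [vq [z [Kz /(cell_rel_span A_low)/coord0]]].
  rewrite !(linearB (cell_coord q)) /= !cell_coord_in eqxx (coord0 _ Awn).
  rewrite (coord0 (attach q z)); last first.
    by apply: span_of_sub (attach_below q z); exact: below_sub.
  by rewrite !subr0 => /eqP; rewrite subr_eq0 => /eqP ->; right.
rewrite LA.
have [vq|nvq] := pselect (valid q); last first.
  exists F, F, (pi \o in_cell q), idfun; split=> //.
  - exact: free_projective.
  - by move=> x; exists x.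
  - move=> x; split=> [/= ->|[w Aw xw]]; first by rewrite !linear0; exact: submodule0 (Lsub _).
    by have [|[/nvq]] := step x w Aw xw.
  - move=> u; split=> [[w /span_ofU1[v [x [Av ->]]] ->]|[_ [x [[w Aw ->] ->]]]].
      by exists (pi v), x; split; [exists v|rewrite linearD].
    exists (w + in_cell q x); last by rewrite linearD.
    apply: (submoduleD (span_of_submodule _)); last by apply: span_of_cell; right.
    by apply: span_of_sub Aw; exact: subsetUl.
have [KKq _] := valid_inv vq; have Ksub := KK_sub KKq.
pose S := Submod Ksub.
exists F, (quot_by S), (pi \o in_cell q), (quot_proj S); split=> //.
- exact: free_projective.
- apply: (CK (cell_ker q) _ (quot_proj S)) => //; first exact: quot_proj_surj.
  exact: quot_proj_eq0.
- exact: quot_proj_surj.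
- move=> x; rewrite quot_proj_eq0 /=; split=> [Kx|[w Aw xw]].
    exists (attach q x).
      by apply: span_of_sub (attach_below q x); exact: below_sub.
    rewrite -[LHS]/(pi (in_cell q x)).
    apply/eqP; rewrite -subr_eq0 -linearB; apply/eqP/pi0; exists 0.
    by rewrite (linear0 base) subr0; exact: cell_rel_gen.
  by have [->|[]] := step x w Aw xw => //; exact: submodule0 Ksub.
- move=> u; split=> [[w /span_ofU1[v [x [Av ->]]] ->]|[_ [x [[w Aw ->] ->]]]].
    by exists (pi v), x; split; [exists v|rewrite linearD].
  exists (w + in_cell q x); last by rewrite linearD.
  apply: (submoduleD (span_of_submodule _)); last by apply: span_of_cell; right.
  by apply: span_of_sub Aw; exact: subsetUl.
Qed.

End CellNames.

(** * Cotorsion pairs from deconstructible classes *)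

Section ProductInjections.
Variables (R : pzRingType) (A B : lmodType R).

Definition prod_inl (a : A) : (A * B)%type := (a, 0).
Definition prod_inr (b : B) : (A * B)%type := (0, b).

Fact prod_inl_linear : linear prod_inl.
Proof. by move=> a x y; congr (_, _); rewrite /= scaler0 addr0. Qed.
HB.instance Definition _ :=
  GRing.isLinear.Build R A (A * B)%type *:%R prod_inl prod_inl_linear.

Fact prod_inr_linear : linear prod_inr.
Proof. by move=> a x y; congr (_, _); rewrite /= scaler0 addr0. Qed.
HB.instance Definition _ :=
  GRing.isLinear.Build R B (A * B)%type *:%R prod_inr prod_inr_linear.

End ProductInjections.

Arguments prod_inl {R} A B a.
Arguments prod_inr {R} A B b.

(** * Extensions, retracts and lifting *)

Section ExtClosure.
Variable R : pzRingType.
Implicit Types A B C E F M N X : lmodType R.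

Lemma ext_vanish_quot F X X' N (q : {linear F -> X}) (q' : {linear F -> X'}) :
  projective F -> surjective q -> surjective q' ->
  (forall x, q x = 0 <-> q' x = 0) -> ext_vanish X N -> ext_vanish X' N.
Proof.
move=> Fproj q_surj q'_surj qq' XN.
apply: (ext_vanish_presentation Fproj q'_surj) => G Gsub Gfun Gdom.
by apply: (XN _ q) => // x; rewrite qq'.
Qed.

(** The map extends from the kernel of [g] to the preimage [E1] of [A] by the hypothesis on [A], and
    then from [E1], the kernel of [p \o g], to [E] by the hypothesis on [C]. *)
Lemma ext_vanish_extension A B C N (i : {linear A -> B}) (p : {linear B -> C}) :
  short_exact i p -> ext_vanish A N -> ext_vanish C N -> ext_vanish B N.
Proof.
move=> [i_inj ip p_surj] AN CN E g g_surj G Gsub Gfun Gdom.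
pose E1 : lmodType R := ker_mod (p \o g).
have E1P (e : E1) : p (g (val e)) = 0 by apply/eqP; exact: (valP e).
pose H : set (E1 * A)%type := [set u | g (val u.1) = i u.2].
have [|||g1 g1P] := @linear_of_rel _ _ _ H.
- split=> [|a u v Hu Hv]; rewrite /H /=; first by rewrite !linear0.
  by rewrite !linearP /= Hu Hv.
- move=> y; rewrite /H /= !linear0 => y0; apply: i_inj; by rewrite -y0 linear0.
- by move=> e; have /ip[a aE] := E1P e; exists a.
pose G1 : set (E1 * N)%type := [set u | G (val u.1, u.2)].
have [||||h1 h1P] := AN E1 g1 _ G1.
- move=> a; have [e ea] := g_surj (i a).
  have eK : e \in ker_pred (p \o g).
    by apply/eqP; rewrite /= ea; apply/ip; exists a.
  exists (KerMod eK); apply: i_inj; rewrite -[LHS]/(i (g1 (KerMod eK))).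
  by rewrite -(g1P (KerMod eK)) /= ea.
- split; first exact: submodule0 Gsub.
  by move=> a u v Gu Gv; exact: Gsub.2 Gu Gv.
- by move=> y /Gfun.
- move=> e; rewrite (_ : rel_dom G1 e <-> rel_dom G (val e)) // Gdom.
  by rewrite (g1P e) /=; split=> [ge0|->]; [apply: i_inj; rewrite ge0|]; rewrite linear0.
pose G2 : set (E * N)%type := [set u | exists e : E1, u = (val e, h1 e)].
have [||||h hP] := CN E (p \o g) _ G2.
- by move=> c; have [b <-] := p_surj c; have [e <-] := g_surj b; exists e.
- split; first by exists 0; rewrite !linear0.
  by move=> a _ _ [e ->] [e' ->]; exists (a *: e + e'); rewrite !linearP.
- move=> y [e [/esym e0 ->]]; rewrite (_ : e = 0) ?linear0 //.
  exact: val_inj.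
- move=> e; split=> [[y [e' [-> _]]]|/eqP eK]; first exact: E1P.
  by exists (h1 (KerMod eK)), (KerMod eK).
exists h => x y xy.
have xK : x \in ker_pred (p \o g).
  apply/eqP; rewrite /= (_ : g x = 0) ?linear0 //.
  by apply/Gdom; exists y.
rewrite (hP x (h1 (KerMod xK))); first exact: h1P.
by exists (KerMod xK).
Qed.

(** The pullback [E'] of [g] along [p] maps onto [X] with the kernel of [g] as its kernel. The
    extension to [E'] is composed with the map sending [e] to [(e, s (g e))]. *)
Lemma ext_vanish_retract M X N (s : {linear M -> X}) (p : {linear X -> M}) :
  (forall x, p (s x) = x) -> ext_vanish X N -> ext_vanish M N.
Proof.
move=> ps XN E g g_surj G Gsub Gfun Gdom.
pose d : {linear (E * X)%type -> M} := (g \o fst) \- (p \o snd).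
pose E' : lmodType R := ker_mod d.
have E'P (u : E') : g (ker_val u).1 = p (ker_val u).2.
  by apply/eqP; rewrite -subr_eq0; exact: (valP u).
have inE' e x : g e = p x -> exists u : E', ker_val u = (e, x).
  move=> gp; have uK : (e, x) \in ker_pred d by rewrite unfold_in /= gp subrr.
  by exists (KerMod uK).
pose G' : set (E' * N)%type := [set u | (ker_val u.1).2 = 0 /\ G ((ker_val u.1).1, u.2)].
have [||||h' h'P] := XN E' (snd \o (val : {linear E' -> _})) _ G'.
- by move=> x; have [e /inE'[u uE]] := g_surj (p x); exists u; rewrite /= uE.
- split; first by split=> //; exact: submodule0 Gsub.
  move=> a u v [u2 Gu] [v2 Gv]; split=> /=; first by rewrite u2 v2 scaler0 addr0.
  exact: Gsub.2 Gu Gv.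
- by move=> y [_ /Gfun].
- move=> u; split=> [[y []]//|/= u2].
  have /Gdom[y uy] : g (ker_val u).1 = 0 by rewrite E'P u2 linear0.
  by exists y.
pose H : set (E * N)%type :=
  [set w | exists u, ker_val u = (w.1, s (g w.1)) /\ w.2 = h' u].
have [|||h hP] := @linear_of_rel _ _ _ H.
- split; first by exists 0; rewrite /= !linear0.
  move=> a [e n] [e' n'] [u [/= uE ->]] [v [/= vE ->]].
  by exists (a *: u + v); rewrite /= !linearP /= uE vE.
- move=> y [u [/= uE ->]]; rewrite (_ : u = 0) ?linear0 //.
  by apply: val_inj; rewrite -[LHS]/(ker_val u) uE !linear0.
- move=> e; have [u uE] := inE' e (s (g e)) (esym (ps _)).
  by exists (h' u), u.
exists h => x y xy; have [u [/= uE ->]] := hP x.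
have gx0 : g x = 0 by apply/Gdom; exists y.
by apply: h'P; split=> /=; rewrite uE ?gx0 ?linear0.
Qed.

(** The extension of [M] by [N] pulled back along [f] has a retraction [r] onto [N]; subtracting
    [i (r e)] makes the second component depend on the first alone. *)
Lemma ext_vanish_lift M N X (Y : lmodType R) (i : {linear N -> X}) (p : {linear X -> Y})
    (f : {linear M -> Y}) :
  short_exact i p -> ext_vanish M N ->
  exists g : {linear M -> X}, forall x, p (g x) = f x.
Proof.
move=> [i_inj ip p_surj] MN.
pose d : {linear (M * X)%type -> Y} := (f \o fst) \- (p \o snd).
pose E : lmodType R := ker_mod d.
have EP (e : E) : f (ker_val e).1 = p (ker_val e).2.
  by apply/eqP; rewrite -subr_eq0; exact: (valP e).
have inE_ m x : f m = p x -> exists e : E, ker_val e = (m, x).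
  move=> fp; have eK : (m, x) \in ker_pred d by rewrite unfold_in /= fp subrr.
  by exists (KerMod eK).
pose G : set (E * N)%type := [set u | ker_val u.1 = (0, i u.2)].
have [||||r rP] := MN E (fst \o (val : {linear E -> _})) _ G.
- by move=> m; have [x /esym/inE_[e eE]] := p_surj (f m); exists e; rewrite /= eE.
- split; first by rewrite /G /= linear0.
  move=> a u v; rewrite /G /= => uE vE.
  by rewrite uE vE linearP; congr (_, _); rewrite /= scaler0 addr0.
- by move=> n [/esym n0]; apply: i_inj; rewrite n0 linear0.
- move=> e; split=> [[n]|/= e1]; first by rewrite /G /= => ->.
  have /ip[n nE] : p (ker_val e).2 = 0 by rewrite -EP e1 linear0.
  by exists n; rewrite /G /= nE -e1 -surjective_pairing.
pose H : set (M * X)%type :=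
  [set u | exists e : E, (ker_val e).1 = u.1 /\ u.2 = (ker_val e).2 - i (r e)].
have [|||g gP] := @linear_of_rel _ _ _ H.
- split; first by exists 0; rewrite /= (linear0 r) (linear0 i) subr0.
  move=> a [m x] [m' x'] [e [/= em ->]] [e' [/= e'm ->]].
  exists (a *: e + e'); rewrite /= em e'm; split=> //.
  by rewrite (linearP r) (linearP i) scalerBr opprD addrACA.
- move=> x [e [/= e1 ->]].
  have /ip[n nE] : p (ker_val e).2 = 0 by rewrite -EP e1 linear0.
  rewrite (rP e n) ?nE ?subrr //.
  by rewrite /G /= nE -e1 -surjective_pairing.
- move=> m; have [x /esym/inE_[e eE]] := p_surj (f m).
  by exists ((ker_val e).2 - i (r e)), e; rewrite eE.
exists g => m; have [e [/= <- ->]] := gP m.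
by rewrite linearB (_ : p (i _) = 0) ?subr0 //; apply/ip; exists (r e).
Qed.

End ExtClosure.

(** * The theorem of Eklof and Trlifaj, and Salce's lemma *)

Section DeconstructibleCotorsion.
Variables (R : pzRingType) (Z : choiceType) (W U : mod_class R).
Notation F := (free_mod R Z).
Hypothesis U_perp : forall M, U M <-> forall N, W N -> ext_vanish M N.
Hypothesis U_filtered : forall M, U M ->
  filtered (fun X => U X /\ exists S : submod F, X = quot_by S) M.

(** Submodules of the one module [F] serve as indices, which keeps the type in the universe
    [small]. *)
Definition decon_index : Type := {S : submod F | U (quot_by S)}.
Definition decon_family (i : decon_index) : lmodType R := quot_by (sval i).

Lemma right_perp_decon N :
  right_perp U N <-> forall i, ext_vanish (decon_family i) N.
Proof.
split=> [UN [S US]|SN M /U_filtered FM]; first exact/Ext1_eq0P/UN.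
apply/Ext1_eq0P/eklof; apply: filtered_sub FM => X [UX [S XS]].
by rewrite XS in UX *; exact: (SN (exist _ S UX)).
Qed.

Lemma decon_cogenerated : cogenerated_by_set U (right_perp U).
Proof.
exists decon_index, decon_family => N; rewrite right_perp_decon.
split=> [SN _ [i ->]|SN i]; first exact/Ext1_eq0P.
by apply/Ext1_eq0P/SN; exists i.
Qed.

Lemma decon_free : U F.
Proof. by apply/U_perp => N _; apply/projective_ext_vanish/free_projective. Qed.

(** Cells are attached along every submodule of [F] with quotient in [U]. The cokernel is filtered
    by [F] and these quotients, and the Eklof lemma against each [N] in [W] puts it in [U]. *)
Lemma special_preenvelope (M : lmodType R) : exists (V1 U1 : lmodType R)
    (i : {linear M -> V1}) (p : {linear V1 -> U1}),
  [/\ right_perp U V1, U U1 & short_exact i p].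
Proof.
pose KK : set (set F) := [set K | exists2 S : submod F, submod_set S = K & U (quot_by S)].
have KK_sub K : KK K -> submodule K by move=> [S <- _]; exact: submodP.
pose V := complex_quot M KK.
pose i : {linear M -> V} := complex_base M KK.
have im_sub : submodule (range i).
  split; first by exists 0; rewrite ?linear0.
  by move=> a _ _ [x _ <-] [y _ <-]; exists (a *: x + y); rewrite ?linearP.
pose p := quot_proj (Submod im_sub).
have ip : exact_at i p.
  move=> y; rewrite quot_proj_eq0 /=.
  by split=> [[x _ <-]|[x <-]]; exists x.
exists V, (quot_by (Submod im_sub)), i, p; split.
- apply/right_perp_decon => -[S US].
  have KS : KK (submod_set S) by exists S.
  exact: (complex_quot_ext_vanish (N := M) KK_sub KS (@quot_proj_surj _ _ S)
    (@quot_proj_eq0 _ _ S)).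
- apply/U_perp => N WN; apply: eklof.
  apply: (complex_coker_filtered (N := M) KK_sub _ _
    (@quot_proj_surj _ _ (Submod im_sub)) ip).
    exact: (U_perp _).1 decon_free N WN.
  move=> K X q [S <- US] q_surj qK.
  apply: (ext_vanish_quot (@free_projective R Z) (@quot_proj_surj _ _ S) q_surj).
    by move=> x; rewrite quot_proj_eq0 qK.
  exact: (U_perp _).1 US N WN.
- split=> //; first exact: (complex_base_inj KK_sub).
  exact: (@quot_proj_surj _ _ (Submod im_sub)).
Qed.

(** The module [X] is the pushout of a free cover of [M] and of a preenvelope of its kernel [K]. It
    is an extension of [M] by [V] and also of [U1] by the free module [F0]; the latter shows that it
    lies in [U]. *)
Lemma decon_complete : complete_pair U (right_perp U).
Proof.
move=> M; split; last exact: special_preenvelope.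
pose F0 : lmodType R := free_mod R M; pose g := Defs.cover M.
pose K : lmodType R := ker_mod g.
have gK (x : K) : g (val x) = 0 by apply/eqP; exact: (valP x).
have inK y : g y = 0 -> exists x : K, val x = y by move=> /eqP yK; exists (KerMod yK).
have [V [U1 [i [p [V_perp U1U [i_inj ip p_surj]]]]]] := special_preenvelope K.
pose D : set (F0 * V)%type := [set u | exists x : K, u = (val x, - i x)].
have D_sub : submodule D.
  split; first by exists 0; rewrite !linear0.
  move=> a _ _ [x ->] [y ->]; exists (a *: x + y).
  by rewrite (linearP i) opprD -scalerN [LHS]surjective_pairing; congr (_, _).
pose X := quot_by (Submod D_sub); pose q := quot_proj (Submod D_sub).
have q_surj : surjective q by exact: quot_proj_surj.
have q0 f v : q (f, v) = 0 <-> D (f, v) by exact: quot_proj_eq0.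
have [|j jP] := @factor_surj _ _ _ _ q (g \o fst) q_surj.
  by move=> [f v] /q0[x [-> _]] /=; rewrite gK.
have [|r rP] := @factor_surj _ _ _ _ q (p \o snd) q_surj.
  move=> [f v] /q0[x [_ ->]] /=; rewrite linearN (_ : p (i x) = 0) ?oppr0 //.
  by apply/ip; exists x.
exists V, X, (q \o prod_inr F0 V), j; split=> //.
- apply/U_perp => N WN.
  apply: (@ext_vanish_extension _ F0 X U1 N (q \o prod_inl F0 V) r); last 2 first.
  + exact/projective_ext_vanish/free_projective.
  + exact: (U_perp _).1 U1U N WN.
  split.
  + move=> f f' /eqP; rewrite -subr_eq0 -linearB => /eqP/q0[x [ff' /esym/eqP]].
    rewrite oppr_eq0 => /eqP ix0; apply/eqP; rewrite -subr_eq0 ff'.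
    by rewrite (_ : x = 0) ?linear0 //; apply: i_inj; rewrite ix0 linear0.
  + move=> y; have [[f v] <-] := q_surj y; rewrite rP /=; split=> [/ip[x <-]|].
      exists (f + val x); apply/eqP; rewrite -subr_eq0 -linearB.
      apply/eqP/q0; exists x; congr (_, _); last by rewrite sub0r.
      by rewrite addrC addrA addNr add0r.
    move=> [f' /eqP]; rewrite -subr_eq0 -linearB => /eqP/q0[x [_ /eqP]].
    rewrite /= sub0r eqr_opp => /eqP ->; apply/ip; by exists x.
  + move=> u; have [v <-] := p_surj u; exists (q (0, v)).
    by rewrite rP.
- split.
  + move=> v v' /eqP; rewrite -subr_eq0 -linearB => /eqP/q0[x [x0 vv']].
    apply/eqP; rewrite -subr_eq0 vv' (_ : x = 0) ?linear0 ?oppr0 //.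
    by apply: val_inj; move: x0 => /= <-.
  + move=> y; have [[f v] <-] := q_surj y; rewrite jP /=; split=> [/inK[x xf]|].
      exists (v + i x); apply/eqP; rewrite -subr_eq0 -linearB.
      apply/eqP/q0; exists (- x); congr (_, _).
        by rewrite sub0r -xf linearN.
      by rewrite (linearN i) opprK addrC addrA addNr add0r.
    move=> [v' /eqP]; rewrite -subr_eq0 -linearB => /eqP/q0[x [/eqP]].
    by rewrite sub0r eqr_oppLR => /eqP -> _; rewrite linearN gK oppr0.
  + move=> m; have [f <-] := cover_surj m; exists (q (f, 0)).
    by rewrite jP.
Qed.

(** For [M] in the left perpendicular class, the approximation sequence ending in [M] splits, so [M]
    is a retract of a member of [U]. *)
Lemma decon_cotorsion_pair : cotorsion_pair U (right_perp U).
Proof.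
split=> // M; split=> [UM N UN|UM]; first exact: UN.
have [[V [X [i [p [V_perp UX ipS]]]]] _] := decon_complete M.
have [s ps] := ext_vanish_split ((Ext1_eq0P _ _).1 (UM _ V_perp)) ipS.
apply/U_perp => N WN; apply: (ext_vanish_retract ps).
exact: (U_perp _).1 UX N WN.
Qed.

End DeconstructibleCotorsion.

(** * Tensor products with a projective module *)

Section TensorCoordinates.
Variable k : comPzRingType.

HB.instance Definition _ (M N : lmodType k) (x : M) :=
  GRing.isLinear.Build k N (tensor M N) *:%R (tens x) (tens_linearr x).

Lemma tensZl (M N : lmodType k) a (x : M) (y : N) : tens (a *: x) y = a *: tens x y.
Proof. exact: (GRing.scalable_linear (tens_linearl y)). Qed.

Lemma tensor_span (M N : lmodType k) (P : set (tensor M N)) :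
  submodule P -> (forall x y, P (tens x y)) -> forall t, P t.
Proof.
move=> Psub Ptens t; rewrite -(quot_reprK t).
rewrite [quot_repr t]free_modE lin_ext_comp lin_ext_supp.
apply: (submodule_sum Psub) => -[x y] _; apply: (submoduleZ Psub).
exact: Ptens.
Qed.

Section Functoriality.
Variables (M M' N : lmodType k) (f : {linear M -> M'}).

Fact tens_maplE y : linear (fun x => tens (f x) y : tensor M' N).
Proof. by move=> a x x'; rewrite linearP tens_linearl. Qed.

Definition tensor_mapl : tensor M N -> tensor M' N :=
  tensor_lift (fun x y => tens (f x) y).

HB.instance Definition _ :=
  GRing.isLinear.Build k (tensor M N) (tensor M' N) *:%R tensor_mapl
    (tensor_lift_linear tens_maplE (fun x => @tens_linearr k M' N (f x))).

Lemma tensor_mapl_tens x y : tensor_mapl (tens x y) = tens (f x) y.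
Proof.
exact: (tensor_lift_tens tens_maplE (fun x => @tens_linearr k M' N (f x))).
Qed.

End Functoriality.

Variables (B : lmodType k) (iota : {linear B -> free_mod k B}).
Hypothesis iotaK : forall b, Defs.cover B (iota b) = b.

Section Coordinates.
Variable M : lmodType k.
Implicit Types (t : tensor M B) (i : B).

Fact tcoord_linearl i b : linear (fun x : M => (iota b i : k) *: x).
Proof. by move=> a x y; rewrite scalerDr !scalerA mulrC. Qed.

Fact tcoord_linearr i (x : M) : linear (fun b => (iota b i : k) *: x).
Proof. by move=> a b c; rewrite linearP scalerA -scalerDl. Qed.

(** [iota] writes [b] as a finite sum of [iota b i *: i]: a dual basis of [B],
    indexed by [B] itself. *)
Definition tcoord i : tensor M B -> M :=
  tensor_lift (fun x b => (iota b i : k) *: x).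

HB.instance Definition _ i :=
  GRing.isLinear.Build k (tensor M B) M *:%R (tcoord i)
    (tensor_lift_linear (tcoord_linearl i) (tcoord_linearr i)).

Lemma tcoord_tens i x b : tcoord i (tens x b) = (iota b i : k) *: x.
Proof. exact: (tensor_lift_tens (tcoord_linearl i) (tcoord_linearr i)). Qed.

(** Stated for every list containing [r], so that two elements can be expanded over a common
    list. *)
Lemma tcoordE t : exists r : seq B, forall r', uniq r' -> {subset r <= r'} ->
  t = \sum_(i <- r') tens (tcoord i t) i.
Proof.
move: t; apply: tensor_span; first split.
- exists [::] => r' _ _; rewrite big1 // => i _.
  by rewrite linear0 -[0 in LHS](scale0r (0 : M)) tensZl scale0r.
- move=> a u v [r ru] [s sv]; exists (r ++ s) => r' r'_uniq rs.
  rewrite [in LHS](ru r') // => [|i ir]; last by apply: rs; rewrite mem_cat ir.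
  rewrite [in LHS](sv r') // => [|i ir]; last by apply: rs; rewrite mem_cat ir orbT.
  rewrite scaler_sumr -big_split; apply: eq_bigr => i _ /=.
  by rewrite -tens_linearl linearP.
- move=> x b; exists (supp (iota b)) => r r_uniq br.
  rewrite -[in LHS](iotaK b) /= (lin_extE _ r_uniq) => [|i]; last by rewrite -suppP; exact: br.
  rewrite linear_sum; apply: eq_bigr => i _ /=.
  by rewrite linearZ /= tcoord_tens tensZl.
Qed.

Lemma tcoord_inj t : (forall i, tcoord i t = 0) -> t = 0.
Proof.
move=> t0; have [r rE] := tcoordE t.
rewrite (rE (undup r)) ?undup_uniq // => [|i]; last by rewrite mem_undup.
by rewrite big1 // => i _; rewrite t0 -[0 in LHS](scale0r (0 : M)) tensZl scale0r.
Qed.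

End Coordinates.

Lemma tcoord_mapl (M N : lmodType k) (f : {linear M -> N}) i t :
  tcoord i (tensor_mapl f t) = f (tcoord i t).
Proof.
apply: (@tensor_ext k M B N (tcoord i \o tensor_mapl f) (f \o tcoord i)) => x b.
by rewrite /= tensor_mapl_tens !tcoord_tens linearZ.
Qed.

(** The image of [rho (x) B] in [(M (x) B) * (N (x) B)]. *)
Definition tensor_relation (M N : lmodType k) (rho : set (M * N)%type) :
    set (tensor M B * tensor N B)%type :=
  [set u | forall i, rho (tcoord i u.1, tcoord i u.2)].

Section TensorRelation.
Variables (M N : lmodType k) (rho : set (M * N)%type).
Hypothesis rho_sub : submodule rho.

Lemma tensor_relation_submodule : submodule (tensor_relation rho).
Proof.
split=> [|a u v ru rv] i /=; first by rewrite !linear0; exact: submodule0 rho_sub.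
by rewrite !linearP; exact: rho_sub.2 (ru i) (rv i).
Qed.

(** This is the flatness of [B]: coordinates detect zero. *)
Lemma tensor_relation_functional :
  functional_rel rho -> functional_rel (tensor_relation rho).
Proof.
move=> rho_fun s rs; apply: tcoord_inj => i; apply: rho_fun.
by have := rs i; rewrite /= linear0.
Qed.

Lemma tensor_relation_tens x y b :
  rho (x, y) -> tensor_relation rho (tens x b, tens y b).
Proof. by move=> xy i; rewrite /= !tcoord_tens; exact: submodule_pairZ. Qed.

Lemma tensor_relation_sum (J : Type) (r : seq J) (x : J -> M) (y : J -> N) (b : J -> B) :
  (forall j, rho (x j, y j)) ->
  tensor_relation rho (\sum_(j <- r) tens (x j) (b j), \sum_(j <- r) tens (y j) (b j)).
Proof.
move=> xy; elim: r => [|j r IHr].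
  by rewrite !big_nil; exact: (submodule0 tensor_relation_submodule).
rewrite !big_cons; have jr := tensor_relation_tens (b j) (xy j).
exact: (submodule_pairD tensor_relation_submodule jr IHr).
Qed.

Lemma tensor_relation_total t :
  (forall i, rel_dom rho (tcoord i t)) -> rel_dom (tensor_relation rho) t.
Proof.
move=> /choice[s sP]; have [r rE] := tcoordE t.
rewrite (rE (undup r)) ?undup_uniq // => [|i]; last by rewrite mem_undup.
by exists (\sum_(i <- undup r) tens (s i) i); exact: tensor_relation_sum.
Qed.

(** Coordinates do not commute with [g], so both elements are first expanded into pure tensors over
    a common list. *)
Lemma tensor_relation_map (f : {linear M -> M}) (f' : {linear N -> N})
    (g : {linear B -> B}) t s :
  (forall x y, rho (x, y) -> rho (f x, f' y)) ->
  tensor_relation rho (t, s) ->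
  tensor_relation rho (tensor_map f g t, tensor_map f' g s).
Proof.
move=> ff' ts; have [r rE] := tcoordE t; have [r' r'E] := tcoordE s.
have u : uniq (undup (r ++ r')) by exact: undup_uniq.
rewrite (rE _ u) => [|i ir]; last by rewrite mem_undup mem_cat ir.
rewrite (r'E _ u) => [|i ir]; last by rewrite mem_undup mem_cat ir orbT.
rewrite !linear_sum (eq_bigr (fun i => tens (f (tcoord i t)) (g i))); last first.
  by move=> i _; exact: tensor_map_tens.
rewrite (eq_bigr (fun i => tens (f' (tcoord i s)) (g i))); last first.
  by move=> i _; exact: tensor_map_tens.
by apply: tensor_relation_sum => i; apply: ff'; exact: ts.
Qed.

End TensorRelation.

End TensorCoordinates.

(** * Modules over the group algebra *)

Section GroupLinear.
Variables (k : comPzRingType) (G : groupType).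
Notation kG := (group_alg k G).

Lemma restr_scaleE (M : lmodType kG) (a : k) (u : kG) (x : M) :
  (a *: u) *: x = a *: (u *: x : restr M).
Proof.
rewrite -[RHS]/((a *: (1 : kG)) *: (u *: x : M)) scalerA -ga_scalerAl.
by rewrite mul1r.
Qed.

Lemma ga_scaleE (M : lmodType kG) (u : kG) (x : M) :
  u *: x = \sum_(g <- supp u) (u g : k) *: (gact g (x : restr M)).
Proof.
rewrite {1}[u]free_modE lin_ext_supp scaler_suml; apply: eq_bigr => g _.
exact: restr_scaleE.
Qed.

Lemma kG_submodule (M : lmodType kG) (L : set M) :
  submodule (L : set (restr M)) -> (forall g (x : restr M), L x -> L (gact g x)) ->
  submodule L.
Proof.
move=> Lsub Lg; split=> [|u x y Lx Ly]; first exact: (submodule0 Lsub).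
apply: (submoduleD Lsub) => //; rewrite ga_scaleE.
apply: (submodule_sum Lsub) => g _; apply: (submoduleZ Lsub); exact: Lg.
Qed.

Section RestrMap.
Variables (M N : lmodType kG) (f : {linear M -> N}).

Definition restr_map : restr M -> restr N := f.

Fact restr_map_linear : linear restr_map.
Proof. move=> a x y; exact: (linearP f (a *: (1 : kG))). Qed.
HB.instance Definition _ :=
  GRing.isLinear.Build k (restr M) (restr N) *:%R restr_map restr_map_linear.

Lemma linear_gact g (x : restr M) : f (gact g x) = gact g (f x : restr N).
Proof. exact: linearZ. Qed.

End RestrMap.

Lemma kG_linear (M N : lmodType kG) (f : restr M -> restr N) :
  linear f -> (forall g x, f (gact g x) = gact g (f x)) ->
  exists h : {linear M -> N}, forall x, h x = f x.
Proof.
move=> f_lin fg; pose fk := mk_linear f_lin.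
have fkg : linear (f : M -> N).
  move=> u x y; rewrite -[LHS]/(fk ((u *: (x : M) : restr M) + y)) linearD.
  congr (_ + _); rewrite !ga_scaleE linear_sum; apply: eq_bigr => g _.
  by rewrite linearZ /= fg.
by exists (mk_linear fkg).
Qed.

End GroupLinear.

(** * The module of [k]-linear maps with the conjugation action, and the tensor-hom adjunction *)

Section LinearMaps.
Variables (k : comPzRingType) (V W : lmodType k).

Definition khom_pred : {pred V -> W} := fun f => `[< linear f >].

Fact khom_submod : submod_closed khom_pred.
Proof.
split=> [|a f g /asboolP fL /asboolP gL]; apply/asboolP=> b x y.
  by rewrite -[RHS]/(b *: (0 : W) + 0) scaler0 addr0.
rewrite -[LHS]/(a *: f (b *: x + y) + g (b *: x + y)) fL gL.
rewrite -[RHS]/(b *: (a *: f x + g x) + (a *: f y + g y)).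
by rewrite !scalerDr !scalerA [a * b]mulrC addrACA.
Qed.

HB.instance Definition _ :=
  GRing.isSubmodClosed.Build k (V -> W) khom_pred khom_submod.

Record khom := KHom { khom_val :> V -> W; _ : khom_val \in khom_pred }.

HB.instance Definition _ := [isSub for khom_val].
HB.instance Definition _ := [Choice of khom by <:].
HB.instance Definition _ := [SubChoice_isSubLmodule of khom by <:].

Lemma khom_linear (f : khom) : linear f.
Proof. by have /asboolP := valP f. Qed.

HB.instance Definition _ (f : khom) :=
  GRing.isLinear.Build k V W *:%R f (khom_linear f).

End LinearMaps.

Section HomModule.
Variables (k : comPzRingType) (G : groupType).
Notation kG := (group_alg k G).
Variable B : lmodType kG.

Section HomModuleDef.
Variable A : lmodType kG.
Notation H := (khom (restr B) (restr A)).

Fact khom_act_subproof (g : G) (f : H) :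
  (fun b => gact g (f (gact g^-1%g b))) \in @khom_pred k (restr B) (restr A).
Proof. by apply/asboolP=> a x y; rewrite !linearP. Qed.

Definition khom_act (g : G) (f : H) : H := KHom (khom_act_subproof g f).

Fact khom_act_linear g : linear (khom_act g).
Proof. by move=> a f f'; apply/val_inj/funext => b /=; rewrite linearP. Qed.
HB.instance Definition _ g :=
  GRing.isLinear.Build k H H *:%R (khom_act g) (khom_act_linear g).

Fact khom_act1 f : khom_act 1%g f = f.
Proof. by apply/val_inj/funext => b /=; rewrite invg1 !gact1. Qed.

Fact khom_actM g h f : khom_act (g * h)%g f = khom_act g (khom_act h f).
Proof. by apply/val_inj/funext => b /=; rewrite invgM !gactM. Qed.

Definition hom_mod : lmodType kG :=
  module_of_grep (@GRep k G H (fun g => khom_act g) khom_act1 khom_actM).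

Definition hom_eval (f : hom_mod) (b : restr B) : restr A := (f : H) b.

Lemma hom_ext (f g : hom_mod) : (forall b, hom_eval f b = hom_eval g b) -> f = g.
Proof. by move=> fg; apply: (@val_inj _ _ H); apply/funext => b; exact: fg. Qed.

Lemma hom_eval_linear (f : hom_mod) : linear (hom_eval f).
Proof. exact: khom_linear. Qed.

Lemma hom_evalD (f g : hom_mod) b : hom_eval (f + g) b = hom_eval f b + hom_eval g b.
Proof. by []. Qed.

Lemma hom_evalZ a (f : restr hom_mod) b : hom_eval (a *: f) b = a *: hom_eval f b.
Proof. by rewrite module_of_grep_scale. Qed.

Lemma hom_eval_gact g (f : restr hom_mod) b :
  hom_eval (gact g f) b = gact g (hom_eval f (gact g^-1%g b)).
Proof. by rewrite module_of_grep_act. Qed.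

Lemma hom_mod_of (f : restr B -> restr A) : linear f ->
  exists h : hom_mod, forall b, hom_eval h b = f b.
Proof.
move=> /asboolP f_lin; by exists (KHom (f_lin : f \in @khom_pred k (restr B) (restr A))).
Qed.

End HomModuleDef.

Opaque hom_mod.

Lemma hom_mod_map (A C : lmodType kG) (p : {linear A -> C}) :
  exists h : {linear hom_mod A -> hom_mod C},
    forall f b, hom_eval (h f) b = p (hom_eval f b).
Proof.
have ex (f : hom_mod A) : exists h : hom_mod C, forall b, hom_eval h b = p (hom_eval f b).
  apply: hom_mod_of => a x y; rewrite hom_eval_linear.
  exact: (linearP (restr_map p)).
have [h hP] := choice ex.
have h_lin : linear (h : restr (hom_mod A) -> restr (hom_mod C)).
  move=> a x y; apply: hom_ext => b.
  rewrite hP !hom_evalD !hom_evalZ !hP.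
  exact: (linearP (restr_map p)).
have [|h'' h''P] := kG_linear h_lin.
  move=> g x; apply: hom_ext => b; rewrite hom_eval_gact !hP hom_eval_gact.
  exact: linear_gact.
by exists h'' => f b; rewrite h''P hP.
Qed.

Section Adjunction.
Variables (M A : lmodType kG).
Notation T := (tensor (restr M) (restr B)).

Lemma diag_gact g (t : restr (diag_tensor M B)) : gact g t = diag_act M B g t.
Proof. exact: module_of_grep_act. Qed.

Lemma diag_scale (a : k) (t : restr (diag_tensor M B)) : a *: t = a *: (t : T).
Proof. exact: module_of_grep_scale. Qed.

Lemma diag_lift (f : T -> restr A) :
  linear f ->
  (forall g x b, f (tens (gact g x) (gact g b)) = gact g (f (tens x b))) ->
  exists h : {linear diag_tensor M B -> A}, forall t, h t = f t.
Proof.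
move=> f_linT fg; pose fT := mk_linear f_linT.
have f_lin : linear (f : restr (diag_tensor M B) -> restr A).
  by move=> a x y; rewrite diag_scale; exact: f_linT.
apply: (kG_linear f_lin) => g t; rewrite diag_gact.
apply: (@tensor_ext k _ _ _ (fT \o diag_act M B g) (gact g \o fT)) => x b.
by rewrite /= tensor_map_tens; exact: fg.
Qed.

Lemma tensor_uncurry (f : {linear M -> hom_mod A}) :
  exists h : {linear diag_tensor M B -> A},
    forall (x : restr M) (b : restr B), h (tens x b) = hom_eval (f x) b.
Proof.
pose e (x : restr M) (b : restr B) : restr A := hom_eval (f x) b.
have el b : linear (e^~ b).
  move=> a x y; rewrite /e -hom_evalZ -hom_evalD; congr (hom_eval _ b).
  exact: (linearP (restr_map f)).
have er x : linear (e x) by exact: hom_eval_linear.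
have lE x b : tensor_lift e (tens x b) = e x b by exact: (tensor_lift_tens el er).
have [|h hP] := diag_lift (tensor_lift_linear el er).
  move=> g x b; rewrite !lE /e linear_gact hom_eval_gact.
  by rewrite -gactM mulVg gact1.
by exists h => x b; rewrite hP lE.
Qed.

Lemma diag_tens_gact g (x : restr M) (b : restr B) :
  gact g (tens x b : restr (diag_tensor M B)) = tens (gact g x) (gact g b).
Proof. rewrite diag_gact; exact: tensor_map_tens. Qed.

Lemma tensor_curry (f : {linear diag_tensor M B -> A}) :
  exists h : {linear M -> hom_mod A},
    forall (x : restr M) (b : restr B), hom_eval (h x) b = f (tens x b).
Proof.
have f_lin a (s t : T) : f (a *: s + t) = a *: (f s : restr A) + f t.
  by rewrite -(linearP (restr_map f)) diag_scale.
have ex (x : restr M) : exists h : hom_mod A, forall b, hom_eval h b = f (tens x b).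
  by apply: hom_mod_of => a b c; rewrite tens_linearr f_lin.
have [h hP] := choice ex.
have h_lin : linear (h : restr M -> restr (hom_mod A)).
  move=> a x y; apply: hom_ext => b.
  by rewrite hP hom_evalD hom_evalZ !hP tens_linearl f_lin.
have [|h'' h''P] := kG_linear h_lin.
  move=> g x; apply: hom_ext => b; rewrite hom_eval_gact !hP.
  rewrite -(linear_gact f) diag_tens_gact.
  by rewrite -gactM mulgV gact1.
by exists h'' => x b; rewrite h''P hP.
Qed.

End Adjunction.

Lemma diag_ext (M A : lmodType kG) (f f' : {linear diag_tensor M B -> A}) :
  (forall (x : restr M) (b : restr B), f (tens x b) = f' (tens x b)) ->
  forall t, f t = f' t.
Proof.
move=> ff' t; apply/eqP; rewrite -subr_eq0; apply/eqP.
move: t; apply: (tensor_span (P := [set t | f t - f' t = 0])).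
  have lin0 (h : {linear diag_tensor M B -> A}) :
      h (0 : tensor (restr M) (restr B)) = 0 by exact: linear0.
  split=> [|a s t /= s0 t0]; first by rewrite /= !lin0 subr0.
  have lin (h : {linear diag_tensor M B -> A}) :
      h (a *: s + t) = a *: (h s : restr A) + h t.
    by rewrite -(linearP (restr_map h)) diag_scale.
  rewrite !lin opprD addrACA t0 addr0 -scalerBr.
  exact: (etrans (congr1 (fun y : restr A => a *: y) s0) (scaler0 _ a)).
by move=> x b /=; rewrite ff' subrr.
Qed.

End HomModule.

(** * Projectivity of [M (x) B] as the vanishing of an Ext *)

Section TensorProjective.
Variables (k : comPzRingType) (G : groupType).
Notation kG := (group_alg k G).
Variable B : lmodType kG.
Hypothesis B_proj : projective (restr B : lmodType k).

Lemma diag_map (M N : lmodType kG) (f : {linear M -> N}) :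
  exists h : {linear diag_tensor M B -> diag_tensor N B},
    forall t, h t = tensor_mapl (restr_map f) t.
Proof.
pose l : tensor (restr M) (restr B) -> restr (diag_tensor N B) :=
  tensor_mapl (restr_map f).
have l_lin : linear l.
  move=> a x y; rewrite diag_scale.
  exact: (linearP (tensor_mapl (restr_map f) : {linear _ -> _})).
have lE x b : l (tens x b) = tens (restr_map f x) b by exact: tensor_mapl_tens.
have [|h hP] := diag_lift l_lin; last by exists h.
by move=> g x b; rewrite !lE diag_tens_gact; congr tens; exact: linear_gact.
Qed.

Section DiagRelation.
Variable iota : {linear restr B -> free_mod k (restr B)}.
Hypothesis iotaK : forall b, Defs.cover (restr B) (iota b) = b.
Variables (M N : lmodType kG) (rho : set (M * N)%type).
Hypothesis rho_sub : submodule rho.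

Lemma restr_rel_submodule : submodule (rho : set (restr M * restr N)%type).
Proof.
have [rho0 rhoP] := rho_sub; split=> // a u v ru rv.
exact: (rhoP (a *: (1 : kG))).
Qed.

Definition diag_relation : set (diag_tensor M B * diag_tensor N B)%type :=
  tensor_relation iota (rho : set (restr M * restr N)%type).

Lemma diag_relation_submodule : submodule diag_relation.
Proof.
have [r0 rP] := tensor_relation_submodule iota restr_rel_submodule.
apply: kG_submodule.
  split=> // a u v ru rv; have := rP a u v ru rv.
  rewrite /diag_relation; congr (tensor_relation iota _ _).
  rewrite [LHS]surjective_pairing [RHS]surjective_pairing; congr (_, _).
    by congr (_ + _); exact: (esym (diag_scale a (u.1 : restr (diag_tensor M B)))).
  by congr (_ + _); exact: (esym (diag_scale a (u.2 : restr (diag_tensor N B)))).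
move=> g [t s] ts.
have -> : gact g ((t, s) : restr (diag_tensor M B * diag_tensor N B)%type) =
    (diag_act M B g t, diag_act N B g s).
  by congr (_, _); [exact: (@diag_gact k G B M g t)|exact: (@diag_gact k G B N g s)].
have gr (x : restr M) (y : restr N) : rho (x, y) -> rho (gact g x, gact g y).
  exact: (submodule_pairZ (ga_elt k g) rho_sub).
exact: (@tensor_relation_map k (restr B) iota iotaK (restr M) (restr N) rho
  restr_rel_submodule (gact g) (gact g) (gact g) t s gr ts).
Qed.

End DiagRelation.

(** By adjunction a map to [C] becomes a map from [M] to [hom_mod B C]. Projectivity of [B] over [k]
    keeps the sequence of [hom_mod B] on [Z], [A], [C] exact, and the vanishing of Ext against
    [hom_mod B Z] gives the lift. *)
Lemma projective_of_ext_vanish (M : lmodType kG) :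
  (forall A : lmodType kG, ext_vanish M (hom_mod B A)) ->
  projective (diag_tensor M B).
Proof.
move=> MH A C p f p_surj.
have [f' f'P] := tensor_curry f.
pose Z : lmodType kG := ker_mod p.
have [Hj HjP] := @hom_mod_map k G B Z A (val : {linear ker_mod p -> A}).
have [Hp HpP] := @hom_mod_map k G B A C p.
have HE : short_exact Hj Hp.
  split.
  - move=> x y xy; apply: hom_ext => b; apply: val_inj.
    by rewrite -!HjP xy.
  - move=> a; split=> [a0|[z <-]]; last first.
      by apply: hom_ext => b; rewrite HpP HjP; apply/eqP; exact: (valP (hom_eval z b)).
    have ex b : exists z : Z, ker_val z = hom_eval a b.
      have aK : hom_eval a b \in ker_pred p.
        by apply/eqP; rewrite -HpP a0.
      by exists (KerMod aK).
    have [z zP] := choice ex.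
    have z_lin : linear (z : restr B -> restr Z).
      move=> c b b'; apply: val_inj; rewrite -[LHS]/(ker_val _) zP.
      by rewrite hom_eval_linear -!zP.
    have [h hP] := hom_mod_of z_lin.
    by exists h; apply: hom_ext => b; rewrite HjP hP; exact: zP.
  - move=> c; have [h hP] := B_proj (mk_linear (hom_eval_linear c))
      (p_surj : surjective (restr_map p)).
    have [a aP] := hom_mod_of (fun b => linearP h b).
    by exists a; apply: hom_ext => b; rewrite HpP aP; exact: hP.
have [g gP] := ext_vanish_lift f' HE (MH Z).
have [h hP] := tensor_uncurry g.
exists h => t.
apply: (@diag_ext k G B M C (p \o h) f) => x b.
by rewrite /= hP -HpP gP f'P.
Qed.

(** The surjection [Tg] has a section [s], so [t - s (Tg t)] projects onto its kernel. There the
    given map tensored with [B], followed by the evaluation [ev], is defined; the composite,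
    curried, is the extension. *)
Lemma ext_vanish_of_projective (M A : lmodType kG) :
  projective (diag_tensor M B) -> ext_vanish M (hom_mod B A).
Proof.
have [iota iotaK] := B_proj (idfun : {linear restr B -> restr B}) (@cover_surj k (restr B)).
move=> TMproj E g g_surj Q Qsub Qfun Qdom.
have [Tg TgP] := diag_map g.
have TgE (x : restr E) (b : restr B) : Tg (tens x b) = tens (g x : restr M) b.
  by rewrite TgP tensor_mapl_tens.
have Tg_surj : surjective Tg.
  apply: tensor_span => [|x b]; last first.
    by have [y <-] := g_surj x; exists (tens (y : restr E) b); exact: TgE.
  split; first by exists 0; exact: linear0.
  move=> a s t [s' <-] [t' <-].
  exists (a *: (s' : tensor (restr E) (restr B)) + t').
  by rewrite !TgP linearP.
have [s sP] := TMproj _ _ Tg idfun Tg_surj.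
have [ev evP] := tensor_uncurry (idfun : {linear hom_mod B A -> hom_mod B A}).
pose D := diag_relation iota (Q : set (E * hom_mod B A)%type).
have Dsub : submodule D by exact: diag_relation_submodule.
have Dfun : functional_rel D.
  by apply: tensor_relation_functional => // y; exact: Qfun.
pose D' : set (diag_tensor E B * A)%type :=
  [set u | exists v, D (u.1 - s (Tg u.1), v) /\ u.2 = ev v].
have [|||h hP] := @linear_of_rel _ _ _ D'.
- split; first by exists 0; rewrite /= (linear0 Tg) (linear0 s) subr0 linear0;
    split=> //; exact: (submodule0 Dsub).
  move=> a [u y] [v z] [w [/= Dw ->]] [w' [/= Dw' ->]]; exists (a *: w + w').
  split; last by rewrite /= (linearP ev).
  rewrite [X in D (X, _)](_ : _ = a *: (u - s (Tg u)) + (v - s (Tg v))).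
    exact: (submodule_pairP a Dsub Dw Dw').
  by rewrite (linearP Tg) (linearP s) scalerBr opprD addrACA.
- move=> y [v [/=]]; rewrite (linear0 Tg) (linear0 s) => + ->.
  by rewrite subr0 => /Dfun ->; rewrite linear0.
- move=> t; pose t' := t - s (Tg t).
  have Tgt' : Tg t' = 0 by rewrite linearB sP subrr.
  have [|v tv] := @tensor_relation_total _ _ iota iotaK _ _ _ (restr_rel_submodule Qsub) t'.
    move=> i; apply/Qdom.
    rewrite -[LHS]/(restr_map g _) -tcoord_mapl -TgP.
    have -> : Tg t' = (0 : tensor (restr M) (restr B)) by exact: Tgt'.
    exact: (linear0 (tcoord iota i : {linear tensor (restr M) (restr B) -> restr M})).
  by exists (ev v), v.
have [c cP] := tensor_curry h.
exists c => x y xy; apply: hom_ext => b; rewrite cP.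
have [v [/= xv ->]] := hP (tens (x : restr E) b).
suff -> : v = tens (y : restr (hom_mod B A)) b by rewrite evP.
apply: (functional_rel_eq Dsub Dfun xv).
have -> : Tg (tens (x : restr E) b) = 0.
  rewrite TgE (_ : g x = 0); last by apply/Qdom; exists y.
  by rewrite -(scale0r (0 : restr M)) tensZl scale0r.
rewrite (linear0 s) subr0; exact: (tensor_relation_tens iota (restr_rel_submodule Qsub) b xy).
Qed.

End TensorProjective.

(** * Deconstruction *)

Section Deconstruction.
Variables (k : comPzRingType) (G : groupType).
Notation kG := (group_alg k G).
Variable B : lmodType kG.
Hypothesis B_proj : projective (restr B : lmodType k).

Variable iotaB : {linear restr B -> free_mod k (restr B)}.
Hypothesis iotaBK : forall b, Defs.cover (restr B) (iotaB b) = b.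

Variable M : lmodType kG.
Notation TM := (diag_tensor M B).
Variable iota : {linear TM -> free_mod kG TM}.
Hypothesis iotaK : forall t, Defs.cover TM (iota t) = t.

Notation T := (tensor (restr M) (restr B)).
Definition coord (i : restr B) (t : TM) : M := tcoord iotaB i (t : T).

Lemma coverE (v : TM) : v = \sum_(t <- supp (iota v)) (iota v t : kG) *: t.
Proof. by rewrite -{1}[v]iotaK; exact: (lin_ext_supp id (iota v)). Qed.

Definition tens_coef (x : M) (b : restr B) (t : TM) : kG :=
  free_val (iota (tens (x : restr M) b)) t.

Definition tens_supp (x : M) (b : restr B) : seq TM :=
  supp (iota (tens (x : restr M) b)).

Lemma tens_suppP x b t : (t \in tens_supp x b) = (tens_coef x b t != 0).
Proof. exact: suppP. Qed.

Lemma tens_coef0 b t : tens_coef 0 b t = 0.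
Proof.
have t0 : tens (0 : restr M) b = (0 : TM).
  by rewrite -(scale0r (0 : restr M)) tensZl scale0r.
by rewrite /tens_coef [tens _ _]t0 linear0.
Qed.

Lemma tens_coef_linear a (x y : restr M) b t :
  tens_coef (a *: x + y) b t = (a *: (1 : kG)) * tens_coef x b t + tens_coef y b t.
Proof.
have E : tens (a *: x + y) b = (a *: (1 : kG)) *: (tens x b : TM) + tens y b.
  rewrite tens_linearl; congr (_ + _).
  exact: (esym (diag_scale a (tens x b : restr TM))).
by rewrite /tens_coef [tens _ _]E linearP.
Qed.

Lemma tens_coef_gact g (x : restr M) b t :
  tens_coef (gact g x) b t = ga_elt k g * tens_coef x (gact g^-1%g b) t.
Proof.
have E : tens (gact g x) b = ga_elt k g *: (tens x (gact g^-1%g b) : TM).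
  have := diag_tens_gact g x (gact g^-1%g b).
  by rewrite -gactM mulgV gact1 => <-.
by rewrite /tens_coef [tens _ _]E linearZ.
Qed.

(** Elements [x] for which the basis elements of [free_mod kG TM] occurring in
    [iota (x (x) b)] all lie in the image of [L (x) B]. *)
Definition saturated_at (L : set M) : set M :=
  [set x | forall b t, t \in tens_supp x b -> forall i, L (coord i t)].

Lemma saturated_atS (L L' : set M) : L `<=` L' -> saturated_at L `<=` saturated_at L'.
Proof. by move=> LL' x xL b t tx i; apply: LL'; exact: xL tx i. Qed.

Lemma saturated_at_submodule (L : set M) : submodule (saturated_at L).
Proof.
apply: kG_submodule.
  split=> [b t|a x y xL yL b t]; first by rewrite tens_suppP tens_coef0 eqxx.
  rewrite tens_suppP tens_coef_linear => tz.
  have [tx|ntx] := boolP (t \in tens_supp x b); first exact: xL tx.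
  have [ty|nty] := boolP (t \in tens_supp y b); first exact: yL ty.
  have /eqP tx : tens_coef x b t == 0 by rewrite -[_ == _]negbK -tens_suppP.
  have /eqP ty : tens_coef y b t == 0 by rewrite -[_ == _]negbK -tens_suppP.
  by move: tz; rewrite tx ty mulr0 addr0 eqxx.
(* The action of [g] on [x] moves [b] to [gact g^-1%g b]: this is why saturation ranges over all
   [b]. *)
move=> g x xL b t; rewrite tens_suppP tens_coef_gact => tz.
suff /xL : t \in tens_supp x (gact g^-1%g b) by [].
rewrite tens_suppP; apply: contraNN tz => /eqP ->; by rewrite mulr0.
Qed.

Definition saturated (L : set M) := submodule L /\ L `<=` saturated_at L.

(** A letter [(b, n, i)] replaces [x] by the coordinate at [i] of the basis element in position [n]
    of [tens_supp x b]. Recording the position and not the element makes the type independent of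
    [M]; a position beyond the end gives 0. *)
Definition closure_index : choiceType := seq (B * nat * B)%type.

Definition closure_step (j : B * nat * B) (x : M) : M :=
  coord j.2 (nth 0 (tens_supp x j.1.1) j.1.2).

Definition closure_elt (x : M) (s : closure_index) : M := foldr closure_step x s.

Definition closure_map (x : M) : {linear free_mod kG closure_index -> M} :=
  lin_ext (closure_elt x).

Lemma closure_map_delta x s : closure_map x (delta kG s) = closure_elt x s.
Proof. exact: lin_ext_delta. Qed.

Definition closure_add (L : set M) (x : M) : set M :=
  [set y | exists l u, L l /\ y = l + closure_map x u].

Lemma closure_add_sub L x : L `<=` closure_add L x.
Proof. by move=> l Ll; exists l, 0; rewrite linear0 addr0. Qed.

Lemma closure_add_map L x u : submodule L -> closure_add L x (closure_map x u).
Proof. by move=> Lsub; exists 0, u; rewrite add0r; split=> //; exact: (submodule0 Lsub). Qed.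

Lemma closure_add_mem L x : submodule L -> closure_add L x x.
Proof.
move=> Lsub; rewrite -{2}[x]/(closure_elt x [::]) -closure_map_delta.
exact: closure_add_map.
Qed.

Lemma closure_add_submodule L x : submodule L -> submodule (closure_add L x).
Proof.
move=> Lsub; split; first exact: closure_add_sub (submodule0 Lsub).
move=> a _ _ [l [u [Ll ->]]] [l' [u' [Ll' ->]]].
exists (a *: l + l'), (a *: u + u'); split; first exact: Lsub.2.
by rewrite linearP scalerDr addrACA.
Qed.

Lemma closure_add_saturated L x : saturated L -> saturated (closure_add L x).
Proof.
move=> [Lsub Lsat]; have L'sub := closure_add_submodule x Lsub.
have satsub := saturated_at_submodule (closure_add L x).
split=> // _ [l [u [Ll ->]]]; apply: (submoduleD satsub).
  exact: (saturated_atS (@closure_add_sub L x) (Lsat _ Ll)).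
rewrite /= lin_ext_supp; apply: (submodule_sum satsub) => s _.
apply: (submoduleZ satsub) => b t tx i.
have -> : coord i t = closure_map x (delta kG ((b, index t (tens_supp (closure_elt x s) b), i) :: s)).
  by rewrite closure_map_delta /= /closure_step /= nth_index.
exact: closure_add_map.
Qed.

(** The crucial point: if [L] and [L'] are both saturated, a map out of
    [(L' / L) (x) B] lifts, since it does so on the basis elements occurring in
    [iota (L' (x) B)], where one may choose [0] on those of [iota (L (x) B)]. *)
Lemma saturated_quot_projective (F X : lmodType kG) (h : {linear F -> M})
    (q : {linear F -> X}) (L L' : set M) :
  saturated L -> saturated L' -> surjective q ->
  (forall u, q u = 0 <-> L (h u)) ->
  (forall y, L' y <-> exists l u, L l /\ y = l + h u) ->
  projective (diag_tensor X B).
Proof.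
move=> [Lsub Lsat] [L'sub L'sat] q_surj qL L'E A C p f p_surj.
(* The graph of the projection from [L'] onto [X], which is [L'] modulo [L]. *)
pose rho : set (M * X)%type := [set v | exists l u, L l /\ v = (l + h u, q u)].
have rho_sub : submodule rho.
  split; first by exists 0, 0; rewrite !linear0 addr0; split=> //; exact: (submodule0 Lsub).
  move=> a _ _ [l [u [Ll ->]]] [l' [u' [Ll' ->]]].
  exists (a *: l + l'), (a *: u + u'); split; first exact: Lsub.2.
  by rewrite !linearP [LHS]surjective_pairing /= scalerDr addrACA.
have rho_fun : functional_rel rho.
  move=> _ [l [u [Ll [/esym/eqP + ->]]]]; rewrite addrC addr_eq0 => /eqP hu.
  by apply/qL; rewrite hu; exact: submoduleN.
pose D := diag_relation iotaB rho.
have Dsub : submodule D by exact: diag_relation_submodule.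
have Dfun : functional_rel D.
  by apply: tensor_relation_functional => // y; exact: rho_fun.
have D0 (t : TM) : (forall i, L (coord i t)) -> D (t, 0).
  move=> tL i; exists (coord i t), 0; rewrite !linear0 addr0.
  split; first exact: tL.
  congr (_, _); exact: (linear0 (tcoord iotaB i : {linear tensor (restr X) (restr B) -> restr X})).
(* Values on the basis indexed by [TM]. The value 0 on elements over [L] makes [kap] vanish on the
   tensors with first factor in [L], because their supports lie over [L]. *)
have ex (t : TM) : exists a : A, (forall s, D (t, s) -> p a = f s) /\
    ((forall i, L (coord i t)) -> a = 0).
  have [tL|tL] := pselect (forall i, L (coord i t)).
    exists 0; split=> // s ts.
    by rewrite (functional_rel_eq Dsub Dfun ts (D0 _ tL)) !linear0.
  have [[s ts]|noS] := pselect (exists s, D (t, s)); last first.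
    by exists 0; split=> // s ts; case: noS; exists s.
  have [a pa] := p_surj (f s); exists a; split=> // s' ts'.
  by rewrite pa (functional_rel_eq Dsub Dfun ts ts').
have [a aP] := choice ex.
pose kap : {linear TM -> A} := (lin_ext a : {linear free_mod kG TM -> A}) \o iota.
have kapE t : kap t = \sum_(s <- supp (iota t)) (iota t s : kG) *: a s.
  exact: lin_ext_supp.
have [c cP] := tensor_curry kap.
have [|phi phiP] := @factor_surj _ _ _ _ q (c \o h) q_surj.
  move=> u /qL Lhu; apply: hom_ext => b; rewrite /= cP kapE.
  rewrite big1_seq // => t /andP[_ tu]; rewrite (aP t).2 ?scaler0 //.
  exact: (Lsat _ Lhu b t tu).
have [psi psiP] := tensor_uncurry phi.
exists psi => t.
apply: (@diag_ext k G B X C (p \o psi) f) => y b; have [u <-] := q_surj y.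
rewrite /= psiP phiP /= cP kapE linear_comb.
have L'hu : L' (h u) by apply/L'E; exists 0, u; rewrite add0r; split=> //; exact: (submodule0 Lsub).
have exs t' : exists s, t' \in tens_supp (h u) b -> D (t', s).
  have [tu|_] := boolP (t' \in tens_supp (h u) b); last by exists 0.
  have [|s ts] := @tensor_relation_total _ _ iotaB iotaBK _ _ _ (restr_rel_submodule rho_sub) t'.
    move=> i; have /L'E[l [v [Ll E]]] := L'sat _ L'hu b t' tu i.
    by exists (q v), l, v; rewrite -E.
  by exists s.
have [s sP] := choice exs.
have -> : \sum_(t' <- tens_supp (h u) b) tens_coef (h u) b t' *: p (a t') =
    f (\sum_(t' <- tens_supp (h u) b) tens_coef (h u) b t' *: s t').
  rewrite linear_comb; apply: eq_big_seq => t' tu; congr (_ *: _).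
  exact: (aP t').1 _ (sP _ tu).
have D1 : D (tens (h u : restr M) b, tens (q u : restr X) b).
  apply: (tensor_relation_tens iotaB (restr_rel_submodule rho_sub)).
  by exists 0, u; rewrite add0r; split=> //; exact: (submodule0 Lsub).
have E : tens (h u : restr M) b =
    \sum_(t' <- tens_supp (h u) b) tens_coef (h u) b t' *: t'.
  exact: coverE.
have := submodule_pair_sum (tens_coef (h u) b) Dsub sP; rewrite -E => D2.
congr (f _); exact: (functional_rel_eq Dsub Dfun D2 D1).
Qed.

(** All saturated submodules serve as terms. The step above [L] adds the closure of a missing [x];
    its quotient is the free module on words modulo the preimage of [L]. *)
Lemma deconstruct : projective TM ->
  filtered (fun X => projective (diag_tensor X B) /\
    exists S : submod (free_mod kG closure_index), X = quot_by S) M.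
Proof.
move=> TMproj; exists saturated; split.
- by move=> L [].
- split; first by split=> // a x y -> ->; rewrite scaler0 addr0.
  move=> _ -> b t; rewrite tens_suppP tens_coef0 eqxx; by [].
- move=> F F0 Fsat Ftot; split.
    by apply: submodule_bigcup => // L /Fsat[].
  move=> x [L FL Lx]; have [_ Lsat] := Fsat _ FL.
  by apply: (saturated_atS _ (Lsat _ Lx)) => y Ly; exists L.
move=> L Lsat; have [|/existsNP[x Lx]] := pselect (forall x, L x).
  by move=> LT; left; apply/seteqP; split=> // x _; exact: LT.
right; have Lsub := Lsat.1; exists (closure_add L x); split.
- exact: closure_add_saturated.
- by move=> /(_ x (closure_add_mem x Lsub)).
have Ssub : submodule [set u | L (closure_map x u)].
  split; first by rewrite /= linear0; exact: (submodule0 Lsub).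
  by move=> a u v /= Lu Lv; rewrite linearP; exact: Lsub.2.
pose S := Submod Ssub.
exists (free_mod kG closure_index), (quot_by S), (closure_map x), (quot_proj S).
split=> //.
- exact: free_projective.
- split; last by exists S.
  apply: (@saturated_quot_projective _ _ (closure_map x) (quot_proj S) L (closure_add L x)) => //.
  + exact: closure_add_saturated.
  + exact: quot_proj_surj.
  + exact: quot_proj_eq0.
- exact: quot_proj_surj.
- exact: quot_proj_eq0.
Qed.

End Deconstruction.

(** * Functions with finitely many values form a projective module *)

Lemma strict_well_order (I : eqType) : exists lt : rel I,
  [/\ transitive lt, irreflexive lt,
      forall i j, [|| lt i j, i == j | lt j i] & well_founded lt].
Proof.
have [R Rwo] := wochoice.well_ordering_principle I.
have Rrefl i : R i i.
  have [|z [[zi zmin] _]] := Rwo (pred1 i); first by exists i; rewrite inE.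
  by have := zmin i; rewrite (eqP zi) !inE => ->.
have Rtot i j : R i j || R j i.
  have [|z [[zij zmin] _]] := Rwo (pred2 i j); first by exists i; rewrite !inE eqxx.
  have := zmin i; have := zmin j; rewrite !inE !eqxx !orbT => /(_ isT) zj /(_ isT) zi.
  by move: zij; rewrite !inE => /orP[/eqP z_|/eqP z_]; rewrite z_ in zi zj; rewrite ?zi ?zj ?orbT.
have Ranti i j : R i j -> R j i -> i = j.
  move=> ij ji; have [|z [_ zuniq]] := Rwo (pred2 i j).
    by exists i; rewrite !inE eqxx.
  by rewrite -(zuniq i) ?(zuniq j) //; split; rewrite ?inE ?eqxx ?orbT //;
     move=> l; rewrite !inE => /orP[]/eqP ->.
have Rtrans j i l : R i j -> R j l -> R i l.
  move=> ij jl.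
  have [|z [[zin zmin] _]] := Rwo (pred3 i j l); first by exists i; rewrite !inE eqxx.
  have zi : R z i by apply: zmin; rewrite !inE eqxx.
  have zj : R z j by apply: zmin; rewrite !inE eqxx orbT.
  have zl : R z l by apply: zmin; rewrite !inE eqxx !orbT.
  move: zin; rewrite !inE => /or3P[]/eqP zE; rewrite zE in zi zj zl => //.
    by rewrite (Ranti i j).
  by rewrite -(Ranti j l).
exists (fun i j => ~~ R j i); split.
- move=> j i l /= ji lj; apply: contraNN lj => li.
  by apply: Rtrans li _; have := Rtot i j; rewrite (negPf ji) orbF.
- by move=> i; rewrite Rrefl.
- move=> i j; have [->|ij] := eqVneq i j; first by rewrite orbT.
  rewrite /=; case Rij: (R i j); case Rji: (R j i) => //=.
  by rewrite (Ranti _ _ Rij Rji) eqxx in ij.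
move=> i; apply: contrapT => nacc.
have [|z [[zA zmin] _]] := Rwo (fun i => `[< ~ Acc (fun i j => ~~ R j i) i >]).
  by exists i; apply/asboolP.
have /asboolP := zA; apply; apply: Acc_intro => j zj; apply: contrapT => jA.
by move: zj; rewrite zmin //; apply/asboolP.
Qed.

(** * Monomials on a cube and their lexicographic order *)

Section Monomials.
Variables (k : comPzRingType) (I : choiceType) (lt : rel I).
Hypotheses (lt_trans : transitive lt) (lt_irr : irreflexive lt).
Hypothesis lt_total : forall i j, [|| lt i j, i == j | lt j i].
Hypothesis lt_wf : well_founded lt.

Notation point := (I -> bool).
Implicit Types (s t : seq I) (L : seq I) (x y : point) (f g : point -> k).

Definition mon s x : k := (all x s)%:R.

Definition descending := pairwise (fun i j => lt j i).

Definition depends_below L m f :=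
  forall x y, (forall i, i \in L -> lt i m -> x i = y i) -> f x = f y.

(** Up to the choice of the finite set [L] of variables, [low L s] is the span
    of the [mon t] for the descending sequences [t] that are lexicographically
    smaller than [s]. *)
Fixpoint low L s f : Prop :=
  if s is m :: s' then
    exists f0 g, [/\ depends_below L m f0, low L s' g
      & forall x, f x = f0 x + (x m)%:R * g x]
  else forall x, f x = 0.

Lemma low0 L s : low L s (fun=> 0).
Proof.
elim: s => //= m s IHs; exists (fun=> 0), (fun=> 0).
by split=> // x; rewrite mulr0 addr0.
Qed.

Lemma low_ext L s f g : f =1 g -> low L s f -> low L s g.
Proof. by move=> /funext ->. Qed.

Lemma low_linear L s a f g :
  low L s f -> low L s g -> low L s (fun x => a * f x + g x).
Proof.
elim: s f g => [f g f0 g0 x|m s IHs f g]; first by rewrite f0 g0 mulr0 addr0.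
move=> [f0 [f1 [df lf fE]]] [g0 [g1 [dg lg gE]]].
exists (fun x => a * f0 x + g0 x), (fun x => a * f1 x + g1 x); split.
- by move=> x y xy; rewrite (df x y) ?(dg x y).
- exact: IHs.
- by move=> x; rewrite fE gE !mulrDr addrACA mulrCA.
Qed.

Lemma mon_dep L m s : {subset s <= L} -> all (lt^~ m) s -> depends_below L m (mon s).
Proof.
move=> sL sm x y xy; rewrite /mon; congr (nat_of_bool _)%:R.
apply: eq_in_all => i si; apply: xy; first exact: sL.
exact: (allP sm).
Qed.

Lemma low_dep L m s f : descending s -> {subset s <= L} -> all (lt^~ m) s ->
  low L s f -> depends_below L m f.
Proof.
elim: s m f => [m f _ _ _ f0 x y _|j s IHs m f]; first by rewrite !f0.
move=> /= /andP[js ds] sL /andP[jm sm] [f0 [g [df lg fE]]] x y xy.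
rewrite !fE (df x y) => [|i iL ij]; last by apply: xy => //; exact: lt_trans jm.
rewrite (xy j) //; last by apply: sL; rewrite mem_head.
congr (_ + _ * _); apply: (IHs m g) => // i si; apply: sL.
by rewrite inE si orbT.
Qed.

(** The leading coefficient [a] is irrelevant: this is where one uses that the
    fibres over the values of the first variable [m] form a subset [P'] of a
    smaller cube, namely the points that extend to [P] in both ways. *)
Lemma low_scale (P : set point) L s a : a != 0 -> descending s -> {subset s <= L} ->
  (exists2 f, low L s f & forall x, P x -> a * mon s x = f x) ->
  exists2 f, low L s f & forall x, P x -> mon s x = f x.
Proof.
move=> a0; elim: s P => [|m s IHs] P.
  move=> _ _ [f f0 fP]; exists f => // x Px; have := fP x Px.
  by rewrite f0 /mon /= mulr1 => /eqP; rewrite (negPf a0).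
move=> /= /andP[sm ds] sL [f [f0 [g [df0 lg fE]]] fP].
have sL' : {subset s <= L} by move=> i si; apply: sL; rewrite inE si orbT.
have mon_cons x : mon (m :: s) x = (x m)%:R * mon s x.
  by rewrite /mon /= -mulnb natrM.
pose agree x y := forall i, i \in L -> lt i m -> x i = y i.
pose P' := [set y | exists x0 x1,
  [/\ P x0, P x1, x0 m = false, x1 m = true & agree x0 y /\ agree x1 y]].
have [|g' lg' gP'] := IHs P' ds sL'.
  exists g => // y [x0 [x1 [Px0 Px1 x0m x1m [x0y x1y]]]].
  (* At [x0] both the monomial and the term multiplied by [x0 m] vanish. *)
  have f00 : f0 y = 0.
    have := fP _ Px0; rewrite fE mon_cons x0m !mul0r mulr0 addr0 => ->.
    exact/esym/df0.
  have := fP _ Px1; rewrite fE mon_cons x1m !mul1r (df0 _ _ x1y) f00 add0r.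
  by rewrite (mon_dep sL' sm x1y) (low_dep ds sL' sm lg x1y).
(* If the fibre of [y] contains a point of [P] with value false at [m], then [f0'] has to vanish
   there, and [g'] is right at the points with value true. Otherwise only the sum [f0' + g'] is
   prescribed. *)
pose f0' y : k := if `[< exists x0, [/\ P x0, x0 m = false & agree x0 y] >]
  then 0 else mon s y - g' y.
exists (fun x => f0' x + (x m)%:R * g' x).
  exists f0', g'; split=> // x y xy; rewrite /f0'.
  have -> : `[< exists x0, [/\ P x0, x0 m = false & agree x0 x] >] =
            `[< exists x0, [/\ P x0, x0 m = false & agree x0 y] >].
    apply/asboolP/asboolP => -[x0 [Px0 x0m ax0]]; exists x0; split=> // i iL im.
      by rewrite ax0 // xy.
    by rewrite ax0 // xy.
  by rewrite (mon_dep sL' sm xy) (low_dep ds sL' sm lg' xy).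
move=> x Px; rewrite mon_cons /f0'; case: asboolP => [[x0 [Px0 x0m x0x]]|nx0].
  case xm: (x m); rewrite ?mul0r ?addr0 // !mul1r add0r.
  by apply: gP'; exists x0, x; split.
case xm: (x m); first by rewrite !mul1r subrK.
by case: nx0; exists x; split.
Qed.

(** The descending sequences below [rcons s m] but not below [s] consist of [s] followed by letters
    below [m]. *)
Lemma low_rcons L s m f : low L (rcons s m) f ->
  exists f1 f2, [/\ low L s f1, depends_below L m f2
    & forall x, f x = f1 x + mon s x * f2 x].
Proof.
elim: s f => [f [f0 [g [df g0 fE]]]|j s IHs f [f0 [g [df lg fE]]]].
  exists (fun=> 0), f0; split=> // x.
  by rewrite fE g0 mulr0 addr0 add0r mul1r.
have [g1 [g2 [lg1 dg2 gE]]] := IHs _ lg.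
exists (fun x => f0 x + (x j)%:R * g1 x), g2; split=> //; first by exists f0, g1.
move=> x; rewrite fE gE mulrDr addrA; congr (_ + _).
by rewrite mulrA /mon /= -mulnb natrM.
Qed.

Fixpoint lex t s : bool :=
  match s, t with
  | [::], _ => false
  | _ :: _, [::] => true
  | m :: s', j :: t' => lt j m || (j == m) && lex t' s'
  end.

Lemma lex_total s t : [|| lex s t, s == t | lex t s].
Proof.
elim: s t => [|i s IHs] [|j t] //=.
have /or3P[->|/eqP ->|->] // := lt_total i j; last by rewrite !orbT.
by rewrite lt_irr eqxx /= eqseq_cons eqxx /=; exact: IHs.
Qed.

Lemma lex_trans : transitive lex.
Proof.
move=> t s u; elim: u s t => [|l u IHu] [|i s] [|j t] //=.
move=> /orP[ij|/andP[/eqP -> st]] /orP[jl|/andP[/eqP <- tu]].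
- by rewrite (lt_trans ij jl).
- by rewrite ij.
- by rewrite jl.
- by rewrite eqxx (IHu _ _ st tu) orbT.
Qed.

Lemma lex_max (r : seq (seq I)) : r != [::] ->
  exists2 s, s \in r & forall t, t \in r -> t != s -> lex t s.
Proof.
elim: r => // s [_ _|t r /(_ isT)[u ur umax] _].
  by exists s; rewrite ?mem_head // => t; rewrite inE => /eqP ->; rewrite eqxx.
have /or3P[su|/eqP su|us] := lex_total s u.
- exists u; first by rewrite inE ur orbT.
  by move=> v; rewrite inE => /orP[/eqP ->//|]; exact: umax.
- exists u; first by rewrite inE ur orbT.
  by move=> v; rewrite inE => /orP[/eqP ->|]; [rewrite su eqxx|exact: umax].
- exists s; first by rewrite mem_head.
  move=> v; rewrite inE => /orP[/eqP ->|vr vs]; first by rewrite eqxx.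
  have [->//|vu] := eqVneq v u.
  exact: lex_trans (umax _ vr vu) us.
Qed.

Lemma low_mon L s t : lex t s -> descending t -> {subset t <= L} -> low L s (mon t).
Proof.
elim: s t => [|m s IHs] [|j t] //= jt => [_ _|].
  exists (mon [::]), (fun=> 0); split=> //; first exact: low0.
  by move=> x; rewrite mulr0 addr0.
move=> /andP[tj dt] tL.
case/orP: jt => [jm|/andP[/eqP jm ts]].
  exists (mon (j :: t)), (fun=> 0); split=> //; last by move=> x; rewrite mulr0 addr0.
    apply: mon_dep => //=; rewrite jm /=; apply: sub_all tj => i ij.
    exact: lt_trans ij jm.
  exact: low0.
exists (fun=> 0), (mon t); split=> //.
  by apply: IHs => // i it; apply: tL; rewrite inE it orbT.
by move=> x; rewrite add0r /mon /= -mulnb natrM jm.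
Qed.
End Monomials.

(** * Noebeling's basis *)

Section FinvalBasis.
Variables (k : comPzRingType) (G : groupType).
Notation I := {classic (set G)}.
Notation B := (finval_fun k G).
Variable lt : rel I.
Hypotheses (lt_trans : transitive lt) (lt_irr : irreflexive lt).
Hypothesis lt_total : forall i j, [|| lt i j, i == j | lt j i].
Hypothesis lt_wf : well_founded lt.

(** [G] becomes a set of points of a cube with one variable for each subset of [G], so that every
    indicator function is a coordinate. *)
Definition membership (x : G) : I -> bool := fun E => `[< (E : set G) x >].

Definition reducible (s : seq I) :=
  exists L f, low lt L s f /\ forall x, mon k s (membership x) = f (membership x).

Definition standard (s : seq I) : bool := `[< descending lt s /\ ~ reducible s >].

Definition standard_seq : choiceType := {s : seq I | standard s}.

Fact mon_finval (s : seq I) : (fun x => mon k s (membership x)) \in @finval_pred k G.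
Proof.
apply/asboolP; apply: (@sub_finite_set _ _ [set 0; 1]).
  by move=> _ [x _ <-]; rewrite /mon; case: all; [right|left].
by rewrite finite_setU; split; exact: finite_set1.
Qed.

Definition mon_fun (s : seq I) : B := FinvalFun (mon_finval s).

Definition mon_comb : {linear free_mod k standard_seq -> B} :=
  lin_ext (fun s : standard_seq => mon_fun (val s)).

Lemma mon_combE u x : mon_comb u x =
  \sum_(s <- supp u) (u s : k) * mon k (val s) (membership x).
Proof.
rewrite /mon_comb /= lin_ext_supp.
by elim: (supp u) => [|s r IHr]; rewrite ?big_nil // !big_cons -IHr.
Qed.

Definition spanned (f : G -> k) := exists u, forall x, mon_comb u x = f x.

Lemma spanned_ext f g : (forall x, f x = g x) -> spanned f -> spanned g.
Proof. by move=> fg [u uf]; exists u => x; rewrite uf. Qed.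

Lemma spannedP a f g : spanned f -> spanned g -> spanned (fun x => a * f x + g x).
Proof.
move=> [u uf] [v vg]; exists (a *: u + v) => x.
by rewrite linearP -uf -vg.
Qed.

Lemma spanned0 : spanned (fun=> 0).
Proof. by exists 0 => x; rewrite linear0. Qed.

Lemma spannedD f g : spanned f -> spanned g -> spanned (fun x => f x + g x).
Proof.
by move=> fs gs; apply: spanned_ext (spannedP 1 fs gs) => x; rewrite mul1r.
Qed.

Lemma spannedZ a f : spanned f -> spanned (fun x => a * f x).
Proof.
by move=> fs; apply: spanned_ext (spannedP a fs spanned0) => x; rewrite addr0.
Qed.

Definition low_spanned (s : seq I) :=
  forall L f, low lt L s f -> spanned (fun x => f (membership x)).

Lemma spanned_mon s : descending lt s -> low_spanned s ->
  spanned (fun x => mon k s (membership x)).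
Proof.
move=> ds ls; have [[L [f [lf fE]]]|nred] := pselect (reducible s).
  by apply: spanned_ext (ls L f lf) => x; rewrite fE.
have ss : standard s by apply/asboolP.
exists (delta k (exist _ s ss : standard_seq)) => x.
by rewrite /mon_comb /= lin_ext_delta.
Qed.

Lemma seq_max (r : seq I) : r != [::] ->
  exists2 j, j \in r & forall i, i \in r -> i = j \/ lt i j.
Proof.
elim: r => // i [_ _|l r /(_ isT)[j jr jmax] _].
  by exists i; rewrite ?mem_head // => j; rewrite inE => /eqP; left.
have /or3P[ij|/eqP ij|ji] := lt_total i j.
- exists j; first by rewrite inE jr orbT.
  by move=> n; rewrite inE => /orP[/eqP ->|]; [right|exact: jmax].
- exists j; first by rewrite inE jr orbT.
  by move=> n; rewrite inE => /orP[/eqP ->|]; [left|exact: jmax].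
- exists i; first exact: mem_head.
  move=> n; rewrite inE => /orP[/eqP ->|/jmax[->|nj]]; [by left|by right|right].
  exact: lt_trans nj ji.
Qed.

Lemma mon_rcons (s : seq I) (m : I) y : mon k (rcons s m) y = mon k s y * (y m)%:R.
Proof. by rewrite /mon all_rcons andbC -mulnb natrM. Qed.

(** Induction on the largest variable [m] of [f], written as [f0] plus [m] times [f1] with both
    depending on smaller variables. The second part has prefix [rcons s m], and [low_rcons] with the
    induction hypothesis transfers [low_spanned] to it. *)
Lemma spanned_mon_mul (m : I) (s L : seq I) (f : (I -> bool) -> k) :
  descending lt (rcons s m) -> low_spanned s ->
  (forall x y, (forall i, i \in L -> i = m \/ lt i m -> x i = y i) -> f x = f y) ->
  spanned (fun x => mon k s (membership x) * f (membership x)).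
Proof.
elim/(well_founded_ind lt_wf): m s L f => m IHm.
have below s L f : descending lt s -> (forall j, lt j m -> descending lt (rcons s j)) ->
    low_spanned s -> depends_below lt L m f ->
    spanned (fun x => mon k s (membership x) * f (membership x)).
  move=> ds dsj ls df; pose L' := [seq i <- L | lt i m].
  have [L'0|/seq_max[j jL' jmax]] := eqVneq L' [::].
    (* No variable below [m] is left: [f] is constant and may be evaluated anywhere. *)
    apply: (spanned_ext _ (spannedZ (f (fun=> false)) (spanned_mon ds ls))) => x.
    rewrite mulrC; congr (_ * _); apply: df => i iL im.
    have : i \in L' by rewrite mem_filter im.
    by rewrite L'0.
  have jm : lt j m by move: jL'; rewrite mem_filter => /andP[].
  apply: (IHm j jm s L' f (dsj _ jm) ls) => x y xy; apply: df => i iL im.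
  have iL' : i \in L' by rewrite mem_filter im.
  exact: xy (jmax _ iL').
move=> s L f; rewrite /descending pairwise_rcons => /andP[sm ds] ls df.
pose at_m b (y : I -> bool) : I -> bool := fun i => if i == m then b else y i.
pose f0 y := f (at_m false y); pose f1 y := f (at_m true y) - f (at_m false y).
have df_at b : depends_below lt L m (f \o at_m b).
  move=> x y xy; apply: df => i iL; rewrite /at_m; case: eqP => // nim [//|].
  exact: xy.
have dsj j : lt j m -> descending lt (rcons s j).
  move=> jm; rewrite /descending pairwise_rcons ds andbT.
  by apply: sub_all sm => i mi; exact: lt_trans mi.
have dsm : descending lt (rcons s m) by rewrite /descending pairwise_rcons sm.
have lsm : low_spanned (rcons s m).
  move=> L1 g /low_rcons[g1 [g2 [lg1 dg2 gE]]].
  apply: (spanned_ext (fun x => esym (gE (membership x)))).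
  by apply: spannedD; [exact: ls lg1|exact: below dg2].
have part0 : spanned (fun x => mon k s (membership x) * f0 (membership x)).
  exact: below (df_at false).
have part1 : spanned (fun x => mon k (rcons s m) (membership x) * f1 (membership x)).
  apply: (below _ L) => //.
    move=> j jm; rewrite /descending pairwise_rcons; apply/andP; split=> //.
    rewrite all_rcons jm /=; apply: sub_all sm => i mi; exact: lt_trans mi.
  move=> x y xy; have E b : f (at_m b x) = f (at_m b y) by exact: (df_at b _ _ xy).
  by rewrite /f1 !E.
apply: spanned_ext (spannedD part0 part1) => x.
rewrite mon_rcons -mulrA -mulrDr; congr (_ * _); rewrite /f0 /f1.
have -> : f (membership x) = f (at_m (membership x m) (membership x)).
  by congr f; apply/funext => i; rewrite /at_m; case: eqP => // ->.
by case: (membership x m); rewrite ?mul1r ?mul0r ?addr0 // addrC subrK.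
Qed.

Lemma mon_comb_surj : surjective mon_comb.
Proof.
move=> b; suff [u ub] : spanned b by exists u; apply/val_inj/funext.
have indicator (E : set G) : spanned (fun x => (`[< E x >])%:R).
  have := @spanned_mon_mul (E : I) [::] [:: E : I] (fun y => (y (E : I))%:R).
  move=> H; apply: (spanned_ext _ (H _ _ _)) => //.
  - by move=> x; rewrite /mon /= mul1r.
  - by move=> L f f0; apply: spanned_ext spanned0 => x; rewrite f0.
  - by move=> x y xy; rewrite (xy E) ?mem_head //; left.
have /asboolP /finite_seqP[r rE] := valP b.
have br x : b x \in undup r.
  have : range b (b x) by exists x.
  by rewrite rE mem_undup.
have bE x : \sum_(v <- undup r) v * (`[< b x = v >])%:R = b x.
  rewrite (bigD1_seq (b x)) ?undup_uniq //= asboolT // mulr1 big1 ?addr0 // => v vx.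
  by rewrite asboolF ?mulr0 // => bxv; rewrite bxv eqxx in vx.
apply: (spanned_ext bE); elim: (undup r) => [|v r' IHr'].
  by apply: spanned_ext spanned0 => x; rewrite big_nil.
apply: spanned_ext (spannedP v (indicator [set x | b x = v]) IHr') => x.
by rewrite big_cons.
Qed.

(** A relation makes a nonzero multiple of its lexicographically largest monomial low on the image
    of [G]. [low_scale] removes the coefficient, against the irreducibility of a standard
    sequence. *)
Lemma mon_comb_inj u : mon_comb u = 0 -> u = 0.
Proof.
move=> u0; have [u_nil|nnil] := eqVneq (supp u) [::].
  apply/val_inj/funext => s; have : s \notin supp u by rewrite u_nil.
  by rewrite suppP negbK => /eqP.
have [|s0 /mapP[s su s0E] smax] := @lex_max _ lt lt_trans lt_irr lt_total
    [seq val s | s <- supp u].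
  by case: (supp u) nnil.
have us : u s != 0 by rewrite -suppP.
pose L := flatten [seq val t | t <- supp u].
have subL (t : standard_seq) : t \in supp u -> {subset val t <= L}.
  move=> tu i it; apply/flattenP; exists (val t) => //; exact: map_f.
have dt (t : standard_seq) : descending lt (val t).
  by have /asboolP[] := valP t.
have /asboolP[ds nred] := valP s; case: nred.
suff [f lf fE] : exists2 f, low lt L (val s) f &
    forall y, range membership y -> (u s : k) * mon k (val s) y = f y.
  have [|g lg gE] := @low_scale k _ lt lt_trans (range membership) L (val s) _ us ds (subL _ su).
    by exists f.
  by exists L, g; split=> // x; apply: gE; exists x.
exists (fun y => \sum_(t <- supp u | t != s) (- (u t : k)) * mon k (val t) y); last first.
  move=> _ [x _ <-]; have := mon_combE u x; rewrite u0 (bigD1_seq s) ?supp_uniq //=.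
  move/esym/eqP; rewrite addr_eq0 => /eqP ->.
  by rewrite -sumrN; apply: eq_bigr => t _; rewrite mulNr.
have lt_s (t : standard_seq) : t \in supp u -> t != s -> low lt L (val s) (mon k (val t)).
  move=> tu ts; apply: (low_mon k lt_trans _ (dt t) (subL t tu)).
  by rewrite -s0E; apply: smax; [exact: map_f|rewrite s0E (inj_eq val_inj)].
have : {subset supp u <= supp u} by [].
elim: {-2}(supp u) => [_|t r IHr tr].
  by apply: low_ext (low0 _ _ _ _) => y; rewrite big_nil.
have {}IHr : low lt L (val s)
    (fun y => \sum_(j <- r | j != s) - (u j : k) * mon k (val j) y).
  by apply: IHr => j jr; apply: tr; rewrite inE jr orbT.
have [ts|ts] := eqVneq t s.
  by apply: low_ext IHr => y; rewrite big_cons ts eqxx.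
apply: low_ext (low_linear (- (u t : k)) (lt_s t _ ts) IHr) => [y|].
  by rewrite big_cons ts.
by apply: tr; rewrite mem_head.
Qed.

End FinvalBasis.

Lemma projective_bij (R : pzRingType) (P Q : lmodType R) (f : {linear P -> Q}) :
  (forall x, f x = 0 -> x = 0) -> surjective f -> projective P -> projective Q.
Proof.
move=> f_inj f_surj Pproj A C p c p_surj.
have [h hP] := Pproj A C p (c \o f) p_surj.
have [|g gP] := factor_surj (f := h) f_surj.
  by move=> x /f_inj ->; exact: linear0.
by exists g => y; have [x <-] := f_surj y; rewrite gP hP.
Qed.

Lemma finval_projective (k : comPzRingType) (G : groupType) :
  projective (finval_fun k G : lmodType k).
Proof.
have [lt [lt_trans lt_irr lt_total lt_wf]] := strict_well_order {classic (set G)}.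
apply: (projective_bij (f := mon_comb k lt)).
- by move=> u; apply: mon_comb_inj.
- exact: mon_comb_surj.
- exact: free_projective.
Qed.

Lemma restr_BGk_projective (k : comPzRingType) (G : groupType) :
  projective (restr (BGk k G) : lmodType k).
Proof.
have id_lin : linear (id : finval_fun k G -> restr (BGk k G)).
  by move=> a x y; rewrite module_of_grep_scale.
apply: (projective_bij (f := mk_linear id_lin)) => //.
  by move=> y; exists y.
exact: finval_projective.
Qed.

(** * Cofibrant modules as a deconstructible left perpendicular class *)

Lemma Cof_ext_vanish (k : comPzRingType) (G : groupType) (M : lmodType (group_alg k G)) :
  Cof k G M <->
  forall N, (exists A, N = hom_mod (BGk k G) A) -> ext_vanish M N.
Proof.
split=> [MC _ [A ->]|MH].
  exact: (@ext_vanish_of_projective k G _ (@restr_BGk_projective k G) M A MC).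
apply: (@projective_of_ext_vanish k G _ (@restr_BGk_projective k G)) => A.
by apply: MH; exists A.
Qed.

Lemma Cof_filtered (k : comPzRingType) (G : groupType) (M : lmodType (group_alg k G)) :
  Cof k G M ->
  filtered (fun X => Cof k G X /\
    exists S : submod (free_mod (group_alg k G) (closure_index (BGk k G))),
      X = quot_by S) M.
Proof.
move=> MC.
have [iotaB iotaBK] := @restr_BGk_projective k G _ _ _ idfun (@cover_surj _ (restr (BGk k G))).
have [iota iotaK] := MC _ _ _ idfun (@cover_surj _ (diag_tensor M (BGk k G))).
exact: (deconstruct iotaBK iotaK).
Qed.

Theorem theorem2p4 (k : comPzRingType) (G : groupType) :
  [/\ cotorsion_pair (Cof k G) (right_perp (Cof k G)),
      cogenerated_by_set (Cof k G) (right_perp (Cof k G))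
    & complete_pair (Cof k G) (right_perp (Cof k G))].
Proof.
have CofW := @Cof_ext_vanish k G; have CofF := @Cof_filtered k G.
split.
- exact: decon_cotorsion_pair CofW CofF.
- exact: decon_cogenerated CofF.
- exact: decon_complete CofW CofF.
Qed.
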